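(* Let $q$ be a prime power, let $n\ge 1$, and let $\psi(T)\in\mathbb{F}_q[T]$ be a monic irreducible polynomial of degree $n$. For an integer $m\ge1$, a polynomial $\gamma(T)\in\mathbb{F}_q[T]$ and an integer $k\ge1$, let $N_k(\gamma,m,\psi)$ denote the number of $2k$-tuples $(x_1,\dots,x_{2k})$ of polynomials $x_i\in\mathbb{F}_q[T]$ with $\deg_T x_i\le m-1$ and $x_i(T)+\gamma(T)\not\equiv 0\pmod{\psi(T)}$ for all $i$, satisfying the congruence $$\frac{1}{x_1(T)+\gamma(T)}+\cdots+\frac{1}{x_k(T)+\gamma(T)}\equiv \frac{1}{x_{k+1}(T)+\gamma(T)}+\cdots+\frac{1}{x_{2k}(T)+\gamma(T)}\pmod{\psi(T)}.$$ Then, for every fixed $k\ge 1$, uniformly over $q$ and $\gamma\in\mathbb{F}_q[T]$ (and $\psi$), if $m<n/(4k^2-2k)$ then $$N_k(\gamma,m,\psi)\le q^{(k+o(1))m}\quad\text{as } m\to\infty.$$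
   Context: Inverses are taken in the field $\mathbb{F}_q[T]/(\psi(T))\cong\mathbb{F}_{q^n}$. The $o(1)$ term tends to $0$ as $m\to\infty$ and depends only on $k$. *)

(* Defs.v *)
From HB Require Import structures.
From mathcomp Require Import all_boot all_order all_algebra all_field.
From mathcomp Require Import all_classical all_reals all_analysis.

Set Implicit Arguments.
Unset Strict Implicit.
Unset Printing Implicit Defensive.

Import Order.TTheory GRing.Theory Num.Theory.

Local Open Scope ring_scope.

Section ReciprocalSums.
Variables (F : finFieldType) (psi : {poly F}).
Hypothesis hpsi : monic_irreducible_poly psi.

Definition residue (p : {poly F}) : {poly %/ psi with hpsi} := in_qpoly psi p.

(* [{poly_m F}] is the type of polynomials of size at most m, i.e. of degree at
   most m - 1 (including 0). The 2k-tuple is indexed by ['I_(k + k)]: the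
   indices [lshift k i] are 1, ..., k and the indices [rshift k i] are
   k + 1, ..., 2k. *)
Definition reciprocal_solutions (k : nat) (gamma : {poly F}) (m : nat) :
    {set {ffun 'I_(k + k) -> {poly_m F}}} :=
  [set x : {ffun 'I_(k + k) -> {poly_m F}} |
    [forall i, ~~ (psi %| val (x i) + gamma)] &&
    (\sum_(i < k) (residue (val (x (lshift k i)) + gamma))^-1 ==
     \sum_(i < k) (residue (val (x (rshift k i)) + gamma))^-1)].

Definition Nsol (k : nat) (gamma : {poly F}) (m : nat) : nat :=
  #|reciprocal_solutions k gamma m|.

End ReciprocalSums.

(* Main.v *)
Require Import Defs.
From mathcomp Require Import all_boot all_order all_algebra all_field.
From mathcomp Require Import all_classical all_reals all_analysis.
From mathcomp Require Import perm zify ring.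

(** Let [c_1, ..., c_r] be nonzero constants and [y_1, ..., y_r] distinct
    solutions of [sum c_i / (y_i + gamma) = 0] modulo [psi]; the general case
    reduces to this one by grouping equal variables, where a group whose
    coefficient vanishes contains at least two variables and is free.
    The polynomial [Q_y(Z) = sum_i c_i prod_(j <> i) (Z - y_j)] over [F[T]] has
    the root [- gamma] modulo [psi].  Its coefficients are so small that the
    resultant of two such polynomials has degree less than [n], hence
    vanishes; so all the [Q_y] share a factor with a fixed one, and it is
    enough to count the [y] for which [Q_y] is a multiple of a fixed primitive
    polynomial [f(Z)] of degree [e].

    For such [y], a Newton polygon argument at each prime of [F[T]] shows that
    [f(y_i)] divides the [e]-th power of the least common multiple of the
    [gcd(f(y_j), y_i - y_j)], [j <> i].  On the other hand [f] takes values of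
    degree at most [D] on at most [e] balls of radius [D / e].  Choosing the
    [y_i] one after the other, in the given order or in the reverse one, the
    congruences modulo the divisors shared with earlier values save, in one of
    the two orders, half of the total freedom; a Kraft-type inequality counts
    the outcomes.  The divisors themselves are [q^(o(m))] in number, uniformly
    in [q]. *)

Set Implicit Arguments.
Unset Strict Implicit.
Unset Printing Implicit Defensive.
Import Order.TTheory GRing.Theory Num.Theory.
Import numFieldNormedType.Exports.
Local Open Scope ring_scope.

(** * Factorization of polynomials over a field *)

Section PolyFactorization.
Variable F : fieldType.
Implicit Types p u v w : {poly F}.

Lemma irredp_dvd_exists u : (1 < size u)%N ->
  exists2 p, irreducible_poly p & p %| u.
Proof.
have [n le_n] := ubnP (size u); elim: n u le_n => // n IHn u le_n lt1u.
have [irr|red] := pselect (irreducible_poly u); first by exists u.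
have [v [nv1 dvu nvu]] : exists v, [/\ size v != 1%N, v %| u & ~~ (v %= u)].
  apply: contrapT => noV; apply: red; split=> // v nv1 dvu.
  by apply: contrapT => /negP nvu; apply: noV; exists v.
have u0 : u != 0 by rewrite -size_poly_gt0 ltnW.
have v0 : v != 0 by apply: dvdpN0 dvu u0.
have lt1v : (1 < size v)%N by rewrite ltn_neqAle eq_sym nv1 size_poly_gt0.
have ltvu : (size v < size u)%N.
  rewrite ltn_neqAle dvdp_leq // andbT.
  by apply: contra nvu => szE; rewrite -dvdp_size_eqp.
have [p irr dpv] := IHn v (leq_trans ltvu le_n) lt1v.
by exists p => //; apply: dvdp_trans dpv dvu.
Qed.

(** The multiplicity of [p] in [u]. Exponents below [size u] suffice for a nonconstant [p] and a
    nonzero [u]; the empty maximum gives 0 at [u = 0]. *)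
Definition valp p u := (\max_(i < size u | (p ^+ i %| u)%R) i)%N.

Lemma valpP p u n : (1 < size p)%N -> u != 0 ->
  (p ^+ n %| u) = (n <= valp p u)%N.
Proof.
move=> lt1p u0; have su : (0 < size u)%N by rewrite size_poly_gt0.
apply/idP/idP => [dpn|le_n].
  suff ltn : (n < size u)%N by rewrite /valp (bigop.bigmax_sup (Ordinal ltn)).
  have := dvdp_leq u0 dpn.
  have p0 : p != 0 by rewrite -size_poly_gt0 ltnW.
  have sp0 : (0 < size (p ^+ n))%N by rewrite size_poly_gt0 expf_neq0.
  rewrite -(prednK sp0) size_exp; apply: leq_trans; rewrite ltnS leq_pmull //.
  by rewrite -ltnS prednK // ltnW.
apply: dvdp_trans (dvdp_exp2l p le_n) _.
rewrite /valp; have := @eq_bigmax_cond _ [pred i : 'I_(size u) | p ^+ i %| u] val.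
case; last by move=> i; rewrite inE => dpi ->.
by apply/card_gt0P; exists (Ordinal su); rewrite inE expr0 dvd1p.
Qed.

Lemma valp_dvd p u : (1 < size p)%N -> p ^+ valp p u %| u.
Proof.
move=> lt1p; have [->|u0] := eqVneq u 0; first by rewrite dvdp0.
by rewrite valpP.
Qed.

Lemma valp_factor p u : (1 < size p)%N -> u != 0 ->
  exists2 v, u = p ^+ valp p u * v & ~~ (p %| v).
Proof.
move=> lt1p u0; have /dvdpP[v uE] := valp_dvd u lt1p.
exists v; first by rewrite mulrC.
apply/negP => dpv; have : p ^+ (valp p u).+1 %| u.
  by rewrite {2}uE exprS dvdp_mul.
by rewrite valpP // ltnn.
Qed.

Lemma irredp_dvdM p u v : irreducible_poly p -> p %| u * v = (p %| u) || (p %| v).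
Proof.
move=> irr; apply/idP/orP => [|[]]; [|exact: dvdp_mulr|exact: dvdp_mull].
have [|ndpu] := boolP (p %| u); first by left.
by rewrite Gauss_dvdpr ?irreducible_poly_coprime //; right.
Qed.

Lemma valpM p u v : irreducible_poly p -> u != 0 -> v != 0 ->
  valp p (u * v) = (valp p u + valp p v)%N.
Proof.
move=> irr u0 v0; have lt1p : (1 < size p)%N by case: irr.
have p0 : p != 0 by apply: irredp_neq0.
have uv0 : u * v != 0 by rewrite mulf_neq0.
have [u' uE ndu] := valp_factor lt1p u0; have [v' vE ndv] := valp_factor lt1p v0.
apply/eqP; rewrite eqn_leq -[X in _ && X]valpP // exprD dvdp_mul ?valp_dvd // andbT.
rewrite leqNgt -valpP // exprS {2}uE {2}vE mulrACA -exprD mulrC.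
by rewrite dvdp_mul2l ?expf_neq0 // irredp_dvdM // negb_or ndu.
Qed.

(** Split off the full power of one irreducible factor: it is coprime to the cofactor, so both
    divide [w] as soon as each does, and the cofactor is smaller. *)
Lemma dvdp_irredp_powers u w :
  (forall p n, irreducible_poly p -> p ^+ n %| u -> p ^+ n %| w) ->
  u != 0 -> u %| w.
Proof.
have [n le_n] := ubnP (size u); elim: n u le_n => // n IHn u le_n pow u0.
have [lt1u|] := ltnP 1 (size u); last first.
  rewrite leq_eqVlt ltnS leqn0 size_poly_eq0 (negPf u0) orbF size_poly_eq1.
  exact: dvdUp.
have [p irr dpu] := irredp_dvd_exists lt1u.
have lt1p : (1 < size p)%N by case: irr.
have [v uE ndv] := valp_factor lt1p u0.
have v0 : v != 0 by apply: contraNneq u0 => v0; rewrite uE v0 mulr0.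
have cop : coprimep (p ^+ valp p u) v.
  by rewrite coprimep_expl // irreducible_poly_coprime.
have dvu : v %| u by rewrite uE dvdp_mull.
rewrite uE Gauss_dvdp // pow ?valp_dvd //=; apply: IHn => // [|q k irrq dqk].
  apply: leq_trans (le_n : size u <= n)%N.
  rewrite ltn_neqAle dvdp_leq // andbT.
  by apply: contra ndv; rewrite dvdp_size_eqp // => /eqp_dvdr ->.
by apply: pow => //; apply: dvdp_trans dqk dvu.
Qed.

Definition lcmp u v := u * v %/ gcdp u v.

Lemma lcmpE u v : lcmp u v * gcdp u v = u * v.
Proof. by rewrite /lcmp divpK // dvdp_mulr // dvdp_gcdl. Qed.

Lemma dvdp_lcml u v : u %| lcmp u v.
Proof.
have [->|v0] := eqVneq v 0; first by rewrite /lcmp mulr0 div0p dvdp0.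
have g0 : gcdp u v != 0 by rewrite gcdp_eq0 negb_and v0 orbT.
by rewrite -(dvdp_mul2r _ _ g0) lcmpE dvdp_mul // dvdp_gcdr.
Qed.

Lemma dvdp_lcmr u v : v %| lcmp u v.
Proof.
have [->|u0] := eqVneq u 0; first by rewrite /lcmp mul0r div0p dvdp0.
have g0 : gcdp u v != 0 by rewrite gcdp_eq0 negb_and u0.
by rewrite -(dvdp_mul2r _ _ g0) lcmpE mulrC dvdp_mul // dvdp_gcdl.
Qed.

Lemma dvdp_lcm u v w : u != 0 -> v != 0 -> lcmp u v %| w = (u %| w) && (v %| w).
Proof.
move=> u0 v0; apply/idP/andP => [dw|[du dv]].
  by split; apply: dvdp_trans dw; rewrite (dvdp_lcml, dvdp_lcmr).
have g0 : gcdp u v != 0 by rewrite gcdp_eq0 negb_and u0.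
rewrite -(dvdp_mul2r _ _ g0) lcmpE (eqp_dvdr _ (mulp_gcdr _ _ _)) dvdp_gcd.
by rewrite [X in (X %| _) && _]mulrC !dvdp_mul.
Qed.

Lemma lcmp_neq0 u v : u != 0 -> v != 0 -> lcmp u v != 0.
Proof.
move=> u0 v0; apply/negP => /eqP l0; have := lcmpE u v.
by rewrite l0 mul0r => /esym/eqP; rewrite mulf_eq0 (negPf u0) (negPf v0).
Qed.

End PolyFactorization.

(** * Newton polygons *)

(** Since [S] exceeds both indices, [S - i] lies between 1 and [S], so the encoded number compares
    first by [a], then in favour of the larger index. *)
Lemma lexicographic_argmin (S a b i j : nat) :
  (i < S -> j < S -> a * S + (S - i) <= b * S + (S - j) ->
   a <= b /\ (i < j -> a < b))%N.
Proof.
move=> lt_i lt_j le_ab; have [lt_ba|lt_ab|eq_ab] := ltngtP b a.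
- have : (b.+1 * S <= a * S)%N by rewrite leq_mul2r lt_ba orbT.
  rewrite mulSn; lia.
- by split.
- by rewrite eq_ab in le_ab; split=> //; lia.
Qed.

(** Here [r] and [s] are the last indices of minimal weight in two factors. In the coefficient of
    index [r + s] of the product, any other term has an index beyond [r] or beyond [s], hence a
    strictly larger valuation. *)
Lemma newton_weight (e a vi vj vr vs i r s : nat) :
  (i < (r + s).+1 -> i <> r ->
   e * vr + a * r <= e * vi + a * i ->
   (r < i -> e * vr + a * r < e * vi + a * i) ->
   e * vs + a * s <= e * vj + a * (r + s - i) ->
   (s < r + s - i -> e * vs + a * s < e * vj + a * (r + s - i)) ->
   vr + vs < vi + vj)%N.
Proof.
rewrite ltnS => le_i ne_ir; set j := (r + s - i)%N.
have eqj : (a * i + a * j = a * r + a * s)%N by rewrite -!mulnDr subnKC.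
move=> le1 lt1 le2 lt2; suff : (e * (vr + vs) < e * (vi + vj))%N.
  by rewrite ltn_mul2l => /andP[].
rewrite !mulnDr; have [lt_ir|lt_ri|//] := ltngtP i r.
  by have := lt2 ltac:(rewrite /j; lia); lia.
by have := lt1 lt_ri; lia.
Qed.

(** The minimal weights do not exceed the weights at index 0, so the product cannot lie strictly
    above the line at index [r + s]. *)
Lemma newton_weight0 (e a v0 w0 vr vs r s n : nat) :
  (e * vr + a * r <= e * v0 + a * 0 -> e * vs + a * s <= e * w0 + a * 0 ->
   n <= vr + vs -> e * (v0 + w0) + 1 <= e * n + a * (r + s) -> False)%N.
Proof.
move=> le1 le2 le_n; have : (e * n <= e * (vr + vs))%N by rewrite leq_mul2l le_n orbT.
rewrite !mulnDr; lia.
Qed.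

Section NewtonPolygon.
Variables (F : fieldType) (p : {poly F}).
Hypothesis irr : irreducible_poly p.
Implicit Types (u v : {poly F}) (P G H : {poly {poly F}}).

Let lt1p : (1 < size p)%N. Proof. by case: irr. Qed.

Lemma valp_polyC (c : F) : c != 0 -> valp p c%:P = 0%N.
Proof.
move=> c0; apply/eqP; rewrite -leqn0 leqNgt -valpP ?polyC_eq0 // expr1.
apply/negP => /dvdp_leq; rewrite polyC_eq0 => /(_ c0).
by rewrite size_polyC c0 leqNgt lt1p.
Qed.

Lemma valp_prod (I : finType) (A : pred I) (b : I -> {poly F}) :
  (forall i, A i -> b i != 0) ->
  valp p (\prod_(i | A i) b i) = (\sum_(i | A i) valp p (b i))%N.
Proof.
move=> b0; have [//] : valp p (\prod_(i | A i) b i) = (\sum_(i | A i) valp p (b i))%N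
    /\ \prod_(i | A i) b i != 0.
elim/big_rec2: _ => [|i n q Ai [<- q0]]; first by rewrite valp_polyC ?oner_eq0.
by rewrite valpM ?b0 // mulf_neq0 ?b0.
Qed.

Variables (e a : nat).
Hypothesis e_gt0 : (0 < e)%N.

(* The Newton polygon of [P], with slopes measured in units of [1/e], lies
   above the line of slope [-a] through [(0, N)], strictly except at [0]. *)
Definition above_line (N : nat) (P : {poly {poly F}}) := forall r,
  exists2 n, (N + (0 < r)%N <= e * n + a * r)%N & p ^+ n %| P`_r.

(** Asking for some exponent [n] with [p ^+ n] dividing, rather than using [valp], lets a zero
    coefficient count as having infinite valuation. *)
Lemma ex_pow_dvdp_sum (I : Type) (s : seq I) (A : pred I) (b : I -> {poly F}) M k :
  (forall i, A i -> exists2 n, (M <= e * n + k)%N & p ^+ n %| b i) ->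
  exists2 n, (M <= e * n + k)%N & p ^+ n %| \sum_(i <- s | A i) b i.
Proof.
move=> ex; elim/big_ind: _ => [|x y [n1 le1 d1] [n2 le2 d2]|//].
  by exists M; rewrite ?dvdp0 //; nia.
exists (minn n1 n2); first by have [] := leqP n1 n2; lia.
by apply: dvdp_add; [apply: dvdp_trans d1|apply: dvdp_trans d2];
  apply: dvdp_exp2l; lia.
Qed.

Lemma above_line_sum (I : Type) (s : seq I) (A : pred I) (G : I -> {poly {poly F}}) N :
  (forall i, A i -> above_line N (G i)) -> above_line N (\sum_(i <- s | A i) G i).
Proof.
move=> ab r; rewrite coef_sum; apply: ex_pow_dvdp_sum => i Ai.
exact: ab.
Qed.

(** For [r > 0], one of the indices [i] and [r - i] is positive, so its factor supplies the extra
    unit that makes the inequality strict. *)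
Lemma above_lineM M N P G :
  above_line M P -> above_line N G -> above_line (M + N) (P * G).
Proof.
move=> abP abG r; rewrite coefM; apply: ex_pow_dvdp_sum => i _.
have [n1 le1 d1] := abP i; have [n2 le2 d2] := abG (r - i)%N.
exists (n1 + n2)%N; last by rewrite exprD dvdp_mul.
have := ltn_ord i; case: r i le1 le2 {d1 d2} => [|r] i le1 le2; first by nia.
by rewrite ltnS => le_i; case: (nat_of_ord i) le_i le1 le2 => [|i']; nia.
Qed.

Lemma above_lineC u : u != 0 -> above_line (e * valp p u) u%:P.
Proof.
move=> u0 [|r]; rewrite coefC /=; first by exists (valp p u); rewrite ?valp_dvd //; lia.
by exists (valp p u).+1; rewrite ?dvdp0 //; nia.
Qed.

Lemma above_line_prod (I : finType) (A : pred I) (G : I -> {poly {poly F}})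
    (N : I -> nat) :
  (forall i, A i -> above_line (N i) (G i)) ->
  above_line (\sum_(i | A i) N i) (\prod_(i | A i) G i).
Proof.
move=> ab; elim/big_rec2: _ => [|i P n Ai abn]; last by apply: above_lineM; [exact: ab|].
have := above_lineC (oner_neq0 {poly F}).
by rewrite valp_polyC ?oner_eq0 // muln0.
Qed.

(** The linear coefficient 1 has valuation 0, so strictness at index 1 is exactly [N < a]. *)
Lemma above_line_XaddC N u : (N < a)%N -> u = 0 \/ (N <= e * valp p u)%N ->
  above_line N ('X + u%:P).
Proof.
move=> lt_Na le_N; case=> [|[|r]]; rewrite coefD coefX coefC /= ?addr0 ?add0r.
- case: le_N => [->|le_N]; first by exists N; rewrite ?dvdp0 //; nia.
  by exists (valp p u); rewrite ?valp_dvd //; lia.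
- by exists 0%N; rewrite ?dvd1p //; lia.
- by exists N; rewrite ?dvdp0 //; nia.
Qed.

(* Minimizing [w i * S + (S - i)], where [S] bounds the indices, selects the last
   of the indices minimizing [w]. *)
Lemma last_minimal_weight (w : nat -> nat) G : G != 0 -> exists r, [/\ G`_r != 0,
  (forall i, G`_i != 0 -> (w r <= w i)%N) &
  (forall i, G`_i != 0 -> (r < i)%N -> (w r < w i)%N)].
Proof.
move=> G0.
have lt_coef i : G`_i != 0 -> (i < size G)%N.
  by apply: contraNltn => /(nth_default 0) ->.
have sG : ((size G).-1 < size G)%N by rewrite prednK ?size_poly_gt0.
have nz0 : G`_(Ordinal sG) != 0 by rewrite /= -lead_coefE lead_coef_eq0.
case: (@arg_minnP _ (Ordinal sG) [pred i : 'I_(size G) | G`_i != 0]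
  (fun i => w i * size G + (size G - i))%N nz0) => r /= nzr minr.
have lex i (nzi : G`_i != 0) : (w r <= w i)%N /\ ((r < i)%N -> (w r < w i)%N).
  exact: lexicographic_argmin (ltn_ord r) (lt_coef i nzi) (minr (Ordinal (lt_coef i nzi)) nzi).
by exists r; split=> // i nzi; have [] := lex i nzi.
Qed.

(* If the Newton polygon of [G] has a segment of slope [-a/e] or steeper at its
   left end, then so has the one of any multiple of [G]. *)
Lemma not_above_line_mul G H : G`_0 != 0 -> H`_0 != 0 -> (0 < a)%N ->
  valp p G`_0 = a -> (size G <= e.+1)%N -> (exists i, ~~ (p %| G`_i)) ->
  ~ above_line (e * valp p (G * H)`_0) (G * H).
Proof.
move=> G0 H0 a_gt0 valG sG [i0 ndi0] ab.
have nzG : G != 0 by apply: contraNneq G0 => ->; rewrite coef0.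
have nzH : H != 0 by apply: contraNneq H0 => ->; rewrite coef0.
have [r [nzr /= minr lastr]] := last_minimal_weight (fun i => e * valp p G`_i + a * i)%N nzG.
have [s [nzs /= mins lasts]] := last_minimal_weight (fun i => e * valp p H`_i + a * i)%N nzH.
have nzi0 : G`_i0 != 0 by apply: contraNneq ndi0 => ->; rewrite dvdp0.
have val0 : valp p G`_i0 = 0%N.
  by apply/eqP; rewrite -leqn0 leqNgt -valpP // expr1.
have lei0 : (i0 <= e)%N.
  rewrite -ltnS; apply: leq_trans sG.
  by move: nzi0; apply: contraNltn => /(nth_default 0) ->.
(* The constant term has weight [e * a]. The index [i0] of a coefficient prime to [p] has weight
   [a * i0], at most that, so 0 is not the last minimal index. *)
have r_gt0 : (0 < r)%N.
  rewrite lt0n; apply/eqP => r0; have := lastr i0 nzi0.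
  rewrite r0 val0 valG; case: posnP => [i00|_ /(_ isT)]; last by nia.
  by move: val0; rewrite i00 valG => a0; move: a_gt0; rewrite a0.
have [n le_n dn] := ab (r + s)%N.
suff n_le : (n <= valp p G`_r + valp p H`_s)%N.
  move: le_n; rewrite coef0M valpM // addn_gt0 r_gt0 /= => le_n.
  exact: newton_weight0 (minr 0%N G0) (mins 0%N H0) n_le le_n.
rewrite leqNgt; apply/negP => lt_n.
(* The whole coefficient and all its terms other than the one at [r] are divisible by this power,
   hence so is that term, against its valuation. *)
have : p ^+ (valp p G`_r + valp p H`_s).+1 %| G`_r * H`_s.
  have lt_r : (r < (r + s).+1)%N by lia.
  have := dvdp_trans (dvdp_exp2l p lt_n) dn.
  rewrite coefM (bigD1 (Ordinal lt_r)) //= addKn dvdp_addl //.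
  apply: (big_ind (fun x => _ %| x)) => [|x y|i /negP ne_ir].
  - exact: dvdp0.
  - exact: dvdp_add.
  have {}ne_ir : nat_of_ord i <> r by move=> ir; apply: ne_ir; apply/eqP/val_inj.
  have [->|nzGi] := eqVneq G`_i 0; first by rewrite mul0r dvdp0.
  have [->|nzHj] := eqVneq H`_(r + s - i) 0; first by rewrite mulr0 dvdp0.
  rewrite valpP ?mulf_neq0 // valpM //.
  apply: (newton_weight (ltn_ord i) ne_ir (minr i nzGi) (lastr i nzGi)
    (mins _ nzHj) (lasts _ nzHj)).
by rewrite valpP ?mulf_neq0 // valpM // ltnn.
Qed.

End NewtonPolygon.

(** * The numerator of a sum of reciprocals *)

Section ReciprocalPolynomial.
Variables (F : fieldType) (n : nat).
Implicit Types (c : 'I_n -> F) (y : 'I_n -> {poly F}).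

Definition recip_poly c y : {poly {poly F}} :=
  \sum_i (c i)%:P *: \prod_(j | j != i) ('X - (y j)%:P).

Lemma recip_poly_comp c y u :
  recip_poly c y \Po ('X + u%:P) = recip_poly c (fun j => y j - u).
Proof.
rewrite /recip_poly rmorph_sum /=; apply: eq_bigr => i _.
rewrite comp_polyZ rmorph_prod /=; congr (_ *: _). apply: eq_bigr => j _.
by rewrite comp_polyB comp_polyX comp_polyC polyCB opprB addrA.
Qed.

Lemma recip_poly_root c y i :
  (recip_poly c y).[y i] = (c i)%:P * \prod_(j | j != i) (y i - y j).
Proof.
rewrite /recip_poly horner_sum (bigD1 i) //= [X in _ + X]big1 ?addr0 => [|l ne_li].
  rewrite hornerZ. rewrite horner_prod; congr (_ * _); apply: eq_bigr => j _.
  by rewrite hornerXsubC.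
rewrite hornerZ horner_prod (bigD1 i) 1?eq_sym //= hornerXsubC.
by rewrite subrr mul0r mulr0.
Qed.

Lemma recip_poly_neq0 c y i : c i != 0 -> injective y -> (recip_poly c y).[y i] != 0.
Proof.
move=> ci0 yI; rewrite recip_poly_root mulf_neq0 ?polyC_eq0 //.
apply/prodf_neq0 => j ne_ji; rewrite subr_eq0.
by apply: contra ne_ji => /eqP/yI ->.
Qed.

(** Move [y i] to the origin. If every [e * valp p (y i - y j)] were below [a], each summand of the
    numerator would lie above the line of slope [-a] through its constant term, which
    [not_above_line_mul] forbids for a multiple of the primitive polynomial [G]. *)
Lemma recip_poly_valp c y i (G : {poly {poly F}}) p :
  (forall j, c j != 0) -> injective y -> G %| recip_poly c y ->
  irreducible_poly p -> (1 < size G)%N -> (exists r, ~~ (p %| G`_r)) ->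
  p %| G.[y i] ->
  exists2 j, j != i & (valp p G.[y i] <= (size G).-1 * valp p (y i - y j))%N.
Proof.
move=> c0 yI dvG irr lt1G [r ndr] dvGi; apply: contrapT => noj.
set e := (size G).-1 in noj; set a := valp p G.[y i] in noj.
have lt1p : (1 < size p)%N by case: irr.
have e_gt0 : (0 < e)%N by rewrite -ltnS prednK // ltnW.
have lt_a j : j != i -> (e * valp p (y i - y j) < a)%N.
  by move=> ne_ji; rewrite ltnNge; apply/negP => le_a; apply: noj; exists j.
have nz_ij j : j != i -> y i - y j != 0.
  by move=> ne_ji; rewrite subr_eq0; apply: contra ne_ji => /eqP/yI ->.
(* Over the ring [{poly F}], divisibility holds only up to a nonzero scalar [d]; it adds the same
   valuation to the polynomial and to its constant term. *)
have [[d H] /= d0 dQ] : exists2 dH : {poly F} * {poly {poly F}}, dH.1 != 0 &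
    dH.1 *: recip_poly c y = G * dH.2.
  have /Pdiv.WeakIdomain.dvdpP[[d H] /= d0 dQ] := dvG.
  by exists (d, H) => //=; rewrite dQ mulrC.
have Qi0 : (recip_poly c y).[y i] != 0 by apply: recip_poly_neq0.
have := congr1 (fun P => P.[y i]) dQ.
rewrite hornerZ hornerM => dQi.
have /andP[Gi0 Hi0] : (G.[y i] != 0) && (H.[y i] != 0).
  by rewrite -negb_or -mulf_eq0 -dQi mulf_neq0.
pose s := 'X + (y i)%:P; pose Gs := G \Po s; pose Hs := H \Po s.
have coef0s P : (P \Po s)`_0 = P.[y i].
  by rewrite -horner_coef0 horner_comp hornerD hornerX hornerC add0r.
have a_gt0 : (0 < a)%N by rewrite -valpP // expr1.
apply: (@not_above_line_mul _ p irr e a e_gt0 Gs Hs); rewrite ?coef0s //.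
- by rewrite /Gs size_comp_poly2 ?size_XaddC // /e prednK // ltnW.
- apply: contrapT => alld; move/negP: ndr; apply.
  have -> : G = Gs \Po ('X - (y i)%:P).
    rewrite -comp_polyA comp_polyD comp_polyX comp_polyC subrK.
    by rewrite comp_polyXr.
  rewrite comp_polyE coef_sum; apply: (big_ind (fun x => p %| x)) => [|x z|k _].
  - exact: dvdp0.
  - exact: dvdp_add.
  rewrite coefZ dvdp_mulr //; apply: contrapT => /negP ndk.
  by apply: alld; exists k.
have cP0 j : (c j)%:P != 0 :> {poly F} by rewrite polyC_eq0.
have -> : (Gs * Hs)`_0 = d * ((c i)%:P * \prod_(j | j != i) (y i - y j)).
  by rewrite coef0M !coef0s -dQi recip_poly_root.
rewrite valpM ?mulf_neq0 //; last by apply/prodf_neq0 => j /nz_ij.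
rewrite valpM //; last by apply/prodf_neq0 => j /nz_ij.
rewrite valp_polyC // valp_prod // add0n mulnDr.
have -> : Gs * Hs = d%:P * recip_poly c (fun j => y j - y i).
  by rewrite -comp_polyM -dQ comp_polyZ mul_polyC recip_poly_comp.
apply: above_lineM => //; first exact: above_lineC.
rewrite big_distrr /=.
apply: above_line_sum => // l _.
have XsubE j : 'X - (y j - y i)%:P = 'X + (y i - y j)%:P :> {poly {poly F}}.
  by rewrite -polyCN opprB.
rewrite -mul_polyC -[X in above_line _ _ _ X]add0n.
apply: above_lineM => //.
  by have := above_lineC irr a e_gt0 (cP0 l); rewrite valp_polyC // muln0.
rewrite [X in above_line _ _ _ _ X](eq_bigr _ (fun j _ => XsubE j)).
have line j : j != i -> above_line p e a (e * valp p (y i - y j)) ('X + (y i - y j)%:P).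
  by move=> ne_ji; apply: above_line_XaddC => //; [exact: lt_a|right].
have [->|ne_li] := eqVneq l i; first exact: above_line_prod.
(* This product lacks the factor of [l] but contains that of [i], which is ['X] after the shift. As
   ['X] lies above every line of height below [a], it replaces the missing factor at height
   [e * valp p (y i - y l)]. *)
rewrite (bigD1 l) // (bigD1 (P := fun j => j != l) i) 1?eq_sym //=.
apply: above_lineM => //.
  by rewrite subrr; apply: above_line_XaddC => //; [exact: lt_a|left].
rewrite (eq_bigl (fun j => (j != l) && (j != i))) => [|j]; last by rewrite andbC.
by apply: above_line_prod => // j /andP[_ /line].
Qed.

End ReciprocalPolynomial.

(** * Points where a polynomial takes small values *)

(** Newton's divided differences: dividing [f - f(z)] by ['X - z] lowers the degree by one and the
    sizes of the values at the other points by at least [rho]. After [e] steps a nonzero constant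
    remains. *)
Lemma divided_difference (F : fieldType) (f : {poly {poly F}}) (zs : seq {poly F})
    (e rho S : nat) :
  size f = e.+1 -> size zs = e.+1 ->
  pairwise (fun z w : {poly F} => rho < size (z - w)%R)%N zs ->
  all (fun z => size f.[z]%R <= S)%N zs -> (e * rho < S)%N.
Proof.
elim: e f zs S => [|e IHe] f [|z zs] S //= sf [szs] /andP[far_z far] /andP[fz fzs].
  have /size_poly1P[c c0 fE] : size f == 1%N by rewrite sf.
  by rewrite mul0n (leq_trans _ fz) // fE hornerC size_poly_gt0.
have /factor_theorem[g gE] : root (f - f.[z]%:P) z.
  by rewrite /root hornerD hornerN hornerC subrr.
have sg : size g = e.+1.
  have sfz : size (f - f.[z]%:P) = e.+2.
    by rewrite size_polyDl ?sf // size_polyN size_polyC; case: eqP.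
  have g0 : g != 0 by apply: contra_eq_neq sfz => g0; rewrite gE g0 mul0r size_poly0.
  by move: sfz; rewrite gE size_Mmonic ?monicXsubC // size_XsubC addn2 => -[].
suff : (e * rho < S - rho)%N by lia.
apply: (IHe g zs) => //; apply/allP => w wzs.
have [->|gw0] := eqVneq g.[w] 0; first by rewrite size_poly0.
have lt_zw : (rho < size (w - z)%R)%N by rewrite -size_polyN opprB (allP far_z).
have := congr1 (fun P => P.[w]) gE.
rewrite hornerD hornerN hornerC hornerM hornerXsubC => gwE.
have : (size (g.[w] * (w - z))%R <= S)%N.
  by rewrite -gwE (leq_trans (size_polyD _ _)) // size_polyN geq_max (allP fzs).
have wz0 : w - z != 0 by rewrite -size_poly_gt0; apply: leq_ltn_trans lt_zw.
rewrite size_mul //; move: lt_zw; have := size_poly_gt0 g.[w]; rewrite gw0.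
by move: (size g.[w]) (size (w - z)) => a b; lia.
Qed.

(** Greedy covering: remove the ball around some point and repeat. The chosen centres are pairwise
    far, so there are at most [e] rounds. *)
Lemma card_by_separation (T : finType) (far : rel T) (e C : nat) (Y : {set T}) :
  (forall s, {subset s <= Y} -> pairwise far s -> (size s <= e)%N) ->
  (forall z, z \in Y -> (#|[set w in Y | ~~ far z w]| <= C)%N) ->
  (#|Y| <= e * C)%N.
Proof.
elim: e Y => [|e IHe] Y sepY ballY.
  have [->|[z zY]] := set_0Vmem Y; first by rewrite cards0.
  suff : (size [:: z] <= 0)%N by [].
  by apply: sepY => // w; rewrite inE => /eqP ->.
have [->|[z zY]] := set_0Vmem Y; first by rewrite cards0.
have YE : Y = [set w in Y | ~~ far z w] :|: [set w in Y | far z w].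
  by apply/setP => w; rewrite !inE -andb_orr orNb andbT.
rewrite YE mulSn (leq_trans (leq_card_setU _ _)) // leq_add ?ballY //.
apply: IHe => [s sY far_s|w].
  suff : (size (z :: s) <= e.+1)%N by [].
  apply: sepY => /= [w|].
    by rewrite inE => /predU1P[->//|/sY]; rewrite inE => /andP[].
  by rewrite far_s andbT; apply/allP => w /sY; rewrite inE => /andP[].
rewrite inE => /andP[wY _]; apply: leq_trans (ballY w wY).
by apply: subset_leq_card; apply/fintype.subsetP => v; rewrite !inE => /andP[/andP[-> _] ->].
Qed.

Section Balls.
Variables (F : finFieldType) (m : nat).
Implicit Types y z : {poly_m F}.

(** The quotient of [z - y] by [M] determines [z]. Truncated subtraction gives the bound 1 once the
    degree of [M] reaches [h]. *)
Lemma card_multiples_ball (M : {poly F}) (h : nat) y :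
  (#|[set z : {poly_m F} | (size (val z - val y)%R <= h)%N && (M %| val z - val y)%R]|
    <= #|F| ^ (h - (size M).-1))%N.
Proof.
rewrite -(card_npoly F (h - (size M).-1)).
pose g z : {poly_(h - (size M).-1) F} := npolyp _ ((val z - val y) %/ M).
rewrite -(@card_in_imset _ _ g) ?max_card // => z1 z2.
have gE z : (size (val z - val y)%R <= h)%N && (M %| val z - val y)%R ->
    val z = val (g z) * M + val y.
  move=> /andP[szy dvM]; rewrite /= npolypK ?divpK ?subrK //.
  have [M0|M0] := eqVneq M 0; last by rewrite size_divp // leq_sub2r.
  by rewrite M0 divp0 size_poly0.
by rewrite !inE => /gE z1E /gE z2E eqg; apply/val_inj; rewrite z1E z2E eqg.
Qed.

(** The radius [(D %/ e).+1] is the least [rho] with [e * rho > D], so [divided_difference] excludes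
    [e + 1] points that are pairwise farther apart. Differences have size at most [m] in any case,
    whence the minimum. *)
Lemma card_small_values (f : {poly {poly F}}) (e D : nat) (M : {poly F})
    (Y : {set {poly_m F}}) :
  size f = e.+1 -> (0 < e)%N ->
  (forall y, y \in Y -> (size f.[val y]%R <= D.+1)%N) ->
  {in Y &, forall y z, M %| val y - val z} ->
  (#|Y| <= e * #|F| ^ (minn m (D %/ e).+1 - (size M).-1))%N.
Proof.
move=> sf e_gt0 fY MY; pose rho := (D %/ e).+1.
apply: (@card_by_separation _ (fun y z => rho < size (val y - val z)%R)%N).
  move=> s sY far_s; rewrite leqNgt; apply/negP => lt_es.
  have szs : size (map val (take e.+1 s)) = e.+1 by rewrite size_map size_takel.
  have : (e * rho < D.+1)%N.
    apply: (divided_difference sf szs).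
      rewrite pairwise_map; apply: subseq_pairwise far_s; exact: take_subseq.
    by apply/allP => _ /mapP[y /mem_take/sY yY ->]; apply: fY.
  by rewrite ltnS leqNgt mulnC ltn_ceil.
move=> z zY; apply: leq_trans (card_multiples_ball M _ z).
apply: subset_leq_card; apply/fintype.subsetP => y; rewrite !inE -leqNgt => /andP[yY le_rho].
rewrite MY // andbT leq_min -size_polyN opprB le_rho andbT.
by apply: leq_trans (size_polyD _ _) _; rewrite size_polyN geq_max !size_npoly.
Qed.

End Balls.

(** * Kraft's inequality *)

Definition monic_part (F : fieldType) (u : {poly F}) := (lead_coef u)^-1 *: u.

Lemma monic_part_eqp (F : fieldType) (u : {poly F}) : monic_part u %= u.
Proof.
have [->|u0] := eqVneq u 0; first by rewrite /monic_part scaler0 eqpxx.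
by rewrite eqp_scale // invr_eq0 lead_coef_eq0.
Qed.

Lemma monic_part_monic (F : fieldType) (u : {poly F}) : u != 0 -> monic_part u \is monic.
Proof.
by move=> u0; rewrite monicE lead_coefZ mulVf // lead_coef_eq0.
Qed.

Definition monic_divisors (F : finFieldType) (u : {poly F}) : seq {poly F} :=
  [seq val v | v <- enum [pred v : {poly_(size u) F} | (val v \is monic) && (val v %| u)]].

Lemma monic_divisorsP (F : finFieldType) (u v : {poly F}) : u != 0 ->
  (v \in monic_divisors u) = (v \is monic) && (v %| u).
Proof.
move=> u0; apply/mapP/andP => [[w]|[mv dv]].
  by rewrite mem_enum inE => /andP[mw dw] ->.
have vE : npolyp (size u) v = v :> {poly F} by rewrite npolypK // dvdp_leq.
by exists (npolyp (size u) v); rewrite // mem_enum inE /= vE mv.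
Qed.

Lemma monic_divisors_uniq (F : finFieldType) (u : {poly F}) : uniq (monic_divisors u).
Proof. by rewrite map_inj_uniq ?enum_uniq //; apply: val_inj. Qed.

Fixpoint choices (T : Type) (ss : seq (seq T)) : seq (seq T) :=
  if ss is s :: ss' then [seq x :: l | x <- s, l <- choices ss'] else [:: [::]].

Lemma size_choices (T : Type) (ss : seq (seq T)) (b : nat) :
  all (fun s => size s <= b)%N ss -> (size (choices ss) <= b ^ size ss)%N.
Proof.
elim: ss => //= s ss IHss /andP[le_s /IHss le_ss].
by rewrite size_allpairs expnS leq_mul.
Qed.

Lemma mem_choices (T U : eqType) (g : U -> T) (S : U -> seq T) (us : seq U) :
  {in us, forall u, g u \in S u} -> map g us \in choices (map S us).
Proof.
elim: us => //= u us IHus gS; apply/allpairsP.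
exists (g u, map g us); rewrite gS ?mem_head //; split=> //=.
by apply: IHus => v vus; apply: gS; rewrite inE vus orbT.
Qed.

Lemma sum_le_fibers (T : finType) (U : eqType) (sig : T -> U) (L : seq U) (A : pred T)
    (g : T -> rat) (b : rat) :
  (forall y, A y -> 0 <= g y) -> (forall y, A y -> sig y \in L) ->
  (forall l, \sum_(y | A y && (sig y == l)) g y <= b) ->
  \sum_(y | A y) g y <= b *+ size L.
Proof.
move=> g0 sigL fib; have -> : b *+ size L = \sum_(l <- L) b.
  by rewrite big_const_seq count_predT -Monoid.iteropE.
apply: (@le_trans _ _ (\sum_(l <- L) \sum_(y | A y && (sig y == l)) g y)); last first.
  exact: ler_sum.
rewrite (exchange_big_dep A) /=; last by move=> l y _ /andP[].
apply: ler_sum => y Ay; rewrite -big_filter.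
have : sig y \in [seq l <- L | A y && (sig y == l)].
  by rewrite mem_filter Ay eqxx sigL.
case: (seq.filter _ _) => // l s _; rewrite big_cons ler_wpDr //.
by apply: sumr_ge0 => i _; apply: g0.
Qed.

Lemma leq_half_of_add a b n : (a + b <= n -> n./2 < a -> b <= n./2)%N.
Proof. have := odd_double_half n; lia. Qed.

Section Kraft.
Variables (F : finFieldType) (m e Delta tau : nat) (f : {poly {poly F}}).
Hypotheses (sf : size f = e.+1) (e_gt0 : (0 < e)%N).
Hypothesis tau_bound : forall u : {poly F}, u != 0 -> (size u <= Delta.+1)%N ->
  (size (monic_divisors u) <= tau)%N.
Local Notation T := {poly_m F}.
Local Notation q := (#|F|%:R : rat).
Implicit Types (y z : T) (s : seq T).

Definition valdeg y := (size f.[val y]).-1.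
Definition common_part y z := monic_part (gcdp f.[val z] (val y - val z)).
Definition shared_part s y : {poly F} :=
  foldr (@lcmp F) 1 [seq common_part y z | z <- s].
(* Up to the factor [e], at most [q ^ cost] polynomials [y] have a given degree
   of [f(y)] and given common parts with the earlier values [s]. *)
Definition cost s y := (minn m (valdeg y %/ e).+1 - (size (shared_part s y)).-1)%N.
Definition bounded_value y := (f.[val y] != 0) && (valdeg y <= Delta)%N.

(** The head of the list is the value chosen last; the tail holds the values chosen before it. *)
Fixpoint total_cost s := if s is y :: s' then (cost s' y + total_cost s')%N else 0%N.

Lemma common_part_neq0 y z : f.[val z] != 0 -> common_part y z != 0.
Proof.
move=> fz0; by rewrite -size_poly_eq0 (eqp_size (monic_part_eqp _)) size_poly_eq0 gcdp_eq0 negb_and fz0.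
Qed.

Lemma common_part_dvdl y z : common_part y z %| f.[val z].
Proof. by rewrite (eqp_dvdl _ (monic_part_eqp _)) dvdp_gcdl. Qed.

Lemma common_part_dvdr y z : common_part y z %| val y - val z.
Proof. by rewrite (eqp_dvdl _ (monic_part_eqp _)) dvdp_gcdr. Qed.

Lemma foldr_lcmp_neq0 (ls : seq {poly F}) :
  all (fun u => u != 0) ls -> foldr (@lcmp F) 1 ls != 0.
Proof.
elim: ls => [|u ls IHls] /=; first by rewrite oner_eq0.
by move=> /andP[u0 /IHls]; apply: lcmp_neq0.
Qed.

Lemma foldr_lcmp_dvd (ls : seq {poly F}) w : all (fun u => u != 0) ls ->
  (foldr (@lcmp F) 1 ls %| w) = all (fun u => u %| w) ls.
Proof.
elim: ls => [|u ls IHls] /=; first by rewrite dvd1p.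
move=> /andP[u0 ls0]; rewrite dvdp_lcm ?IHls //; exact: foldr_lcmp_neq0.
Qed.

Lemma common_parts_neq0 s y : all bounded_value s ->
  all (fun u => u != 0) [seq common_part y z | z <- s].
Proof.
move=> /allP bs; rewrite all_map; apply/allP => z /bs /andP[fz0 _] /=.
exact: common_part_neq0.
Qed.

(** Classify [y] by the degree of [f(y)] and its common parts with [s], which are monic divisors of
    the fixed values [f(z)]: this gives at most [Delta.+1 * tau ^ size s] classes. Members of a
    class are congruent modulo the least common multiple of the parts, so a class of cost [c] has at
    most [e * q ^ c] members, each of weight [q ^ (- c)]. *)
Lemma sum_weights s : all bounded_value s ->
  \sum_(y | bounded_value y) q^-1 ^+ cost s y
    <= e%:R *+ (Delta.+1 * tau ^ size s) :> rat.
Proof.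
move=> bs; pose sig y := (valdeg y, [seq common_part y z | z <- s]).
pose L := [seq (d, l) | d <- iota 0 Delta.+1,
  l <- choices [seq monic_divisors f.[val z] | z <- s]].
have q0 : 0 < q by rewrite ltr0n; apply/card_gt0P; exists 0.
have szL : (size L <= Delta.+1 * tau ^ size s)%N.
  rewrite size_allpairs size_iota leq_mul //.
  rewrite -(size_map (fun z => monic_divisors f.[val z])) size_choices //.
  rewrite all_map; apply/allP => z /(allP bs)/andP[fz0 dz] /=.
  by apply: tau_bound => //; rewrite -ltnS in dz; apply: leq_trans dz; apply: leqSpred.
apply: le_trans (_ : e%:R *+ size L <= _); last by apply: ler_wpMn2l; rewrite ?ler0n.
apply: (@sum_le_fibers _ _ sig) => [y _|y /andP[fy0 dy]|[d ls]].
- by rewrite exprn_ge0 // invr_ge0 ltW.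
- apply/allpairsP; exists (sig y); split; [by rewrite mem_iota| |by []].
  apply: mem_choices => z /(allP bs)/andP[fz0 _].
  rewrite monic_divisorsP // common_part_dvdl andbT monic_part_monic //.
  by rewrite gcdp_eq0 negb_and fz0.
pose M := foldr (@lcmp F) 1 ls; pose c := (minn m (d %/ e).+1 - (size M).-1)%N.
rewrite (eq_bigr (fun _ => q^-1 ^+ c)); last first.
  by move=> y /andP[_ /eqP[yd yls]]; rewrite /cost /shared_part yd yls.
rewrite sumr_const -[leLHS]mulr_natl.
have : (#|[pred y | bounded_value y && (sig y == (d, ls))]| <= e * #|F| ^ c)%N.
  rewrite -cardsE; apply: (card_small_values sf e_gt0) => [y|y z].
    by rewrite inE => /andP[_ /eqP[<- _]]; apply: leqSpred.
  rewrite !inE => /andP[_ /eqP[_ yls]] /andP[_ /eqP[_ zls]].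
  rewrite foldr_lcmp_dvd; last by rewrite -yls common_parts_neq0.
  apply/allP => u uls; have : exists2 x, x \in s & u = common_part y x /\ u = common_part z x.
    move: uls; rewrite -{1}zls => /(nthP 0)[i]; rewrite size_map => lt_i uE.
    have x0 := y; exists (nth x0 s i); first exact: mem_nth.
    split; last by rewrite -uE (nth_map x0).
    by rewrite -uE zls -yls (nth_map x0).
  case=> x xs [uy uz].
  have -> : val y - val z = (val y - val x) - (val z - val x) by rewrite opprB addrA subrK.
  by apply: dvdp_sub; [rewrite uy|rewrite uz]; apply: common_part_dvdr.
rewrite -(ler_nat rat) natrM natrX => le_card.
apply: (@le_trans _ _ (e%:R * q ^+ c * q^-1 ^+ c)).
  by apply: ler_wpM2r => //; rewrite exprn_ge0 // invr_ge0 ltW.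
by rewrite -mulrA -exprMn divff ?expr1n ?mulr1 // gt_eqF.
Qed.

Definition weight s : rat :=
  if all bounded_value s then q^-1 ^+ total_cost s else 0.

Lemma tau_gt0 : (0 < tau)%N.
Proof.
have := tau_bound (oner_neq0 _); rewrite size_poly1 => /(_ isT); apply: leq_trans.
rewrite lt0n size_eq0; apply: contraTneq (monic1 F) => nodiv.
have := monic_divisorsP 1 (oner_neq0 {poly F}).
by rewrite nodiv in_nil dvd1p andbT => <-.
Qed.

(** With the tail fixed, [sum_weights] bounds the sum over the head. Relaxing the exponent of [tau]
    to [r] makes the factor the same at every step. *)
Lemma sum_weight_tuples r r' : (r' <= r)%N ->
  \sum_(t : r'.-tuple T) weight t <= (e * (Delta.+1 * tau ^ r))%:R ^+ r'.
Proof.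
elim: r' => [_|r' IHr' lt_r].
  rewrite expr0 (eq_bigr (fun=> 1)) => [|t _]; last by rewrite tuple0 /weight.
  by rewrite sumr_const card_tuple.
rewrite (reindex (fun p : T * r'.-tuple T => [tuple of p.1 :: p.2])) /=; last first.
  exists (fun t => (thead t, [tuple of behead t])) => [[y t] _|t _] /=.
    by rewrite theadE; congr pair; apply/val_inj.
  by rewrite -tuple_eta.
rewrite -(pair_bigA _ (fun y (t : r'.-tuple T) => weight (y :: t))) exchange_big /=.
have weight0 s : 0 <= weight s.
  by rewrite /weight; case: ifP => // _; rewrite exprn_ge0 // invr_ge0 ler0n.
apply: (@le_trans _ _ (\sum_(t : r'.-tuple T) weight t * (e * (Delta.+1 * tau ^ r))%:R)).
  apply: ler_sum => t _; rewrite /weight /=.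
  have [bt|nbt] := boolP (all bounded_value t); last first.
    by rewrite mul0r big1 // => y _; rewrite andbF.
  under eq_bigr do rewrite andbT.
  rewrite -big_mkcond /= (eq_bigr (fun y => q^-1 ^+ total_cost t * q^-1 ^+ cost t y)).
    rewrite -big_distrr /=; apply: ler_wpM2l.
      by rewrite exprn_ge0 // invr_ge0 ler0n.
    apply: le_trans (sum_weights bt) _; rewrite size_tuple -[leLHS]mulr_natr -natrM ler_nat.
    rewrite leq_mul2l leq_mul2l; apply/orP; right; apply/orP; right.
    by apply: leq_pexp2l; [exact: tau_gt0|exact: ltnW].
  by move=> y _; rewrite exprD mulrC.
rewrite -big_distrl /= exprSr; apply: ler_wpM2r; rewrite ?ler0n //.
by apply: IHr'; apply: ltnW.
Qed.

(* Each tuple is cheap in one of its two orders, so that Kraft's inequality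
   applied to both orders counts them. *)
Lemma card_cheap_tuples r B (S : {set r.-tuple T}) :
  (forall t, t \in S -> all bounded_value t /\
    (total_cost t + total_cost (rev t) <= B)%N) ->
  (#|S| <= 2 * (e * (Delta.+1 * tau ^ r)) ^ r * #|F| ^ B./2)%N.
Proof.
move=> cheap; rewrite -(ler_nat rat) !natrM !natrX.
have q1 : 1 <= q by rewrite ler1n; apply/card_gt0P; exists 0.
have q0 : 0 < q by apply: lt_le_trans q1.
rewrite -ler_pdivrMr ?exprn_gt0 // -exprVn.
have weight0 s : 0 <= weight s.
  by rewrite /weight; case: ifP => // _; rewrite exprn_ge0 // invr_ge0 ler0n.
have weight_rev : \sum_(t : r.-tuple T) weight (rev t) = \sum_(t : r.-tuple T) weight t.
  rewrite [RHS](reindex (fun t : r.-tuple T => [tuple of rev t])) //=.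
  by exists (fun t : r.-tuple T => [tuple of rev t]) => t _; apply/val_inj; rewrite /= revK.
have le_sum := sum_weight_tuples (leqnn r).
have : \sum_(t : r.-tuple T) (weight t + weight (rev t)) <=
    2 * (e * (Delta.+1 * tau ^ r))%:R ^+ r.
  by rewrite big_split /= weight_rev mulr2n mulrDl mul1r lerD.
rewrite !natrM !natrX; apply: le_trans.
have -> : #|S|%:R = \sum_(t in S) 1 :> rat by rewrite sumr_const.
rewrite mulr_suml big_mkcond /=; apply: ler_sum => t _.
case: ifP => [/cheap[bt le_B]|_]; last by rewrite addr_ge0.
rewrite mul1r; have exp_le k : (k <= B./2)%N -> q^-1 ^+ B./2 <= q^-1 ^+ k.
  by move=> le_k; apply: ler_wiXn2l; rewrite ?invr_ge0 ?invf_le1 ?ler0n.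
have [le_t|lt_t] := leqP (total_cost t) B./2.
  by apply: ler_wpDr => //; rewrite /weight bt exp_le.
apply: ler_wpDl => //; rewrite /weight all_rev bt; apply: exp_le.
exact: leq_half_of_add le_B lt_t.
Qed.

End Kraft.

Lemma dvdp_horner_sub (R : idomainType) (f : {poly {poly R}}) (x z : {poly R}) :
  x - z %| f.[x] - f.[z].
Proof.
have /factor_theorem[g gE] : root (f - f.[z]%:P) z.
  by rewrite /root hornerD hornerN hornerC subrr.
have := congr1 (fun P => P.[x]) gE.
by rewrite hornerD hornerN hornerC hornerM hornerXsubC => ->; rewrite dvdp_mull.
Qed.

(** If neither difference is truncated, the sum is [h + (h - a - b)], at most [m + 1]; otherwise a
    single term, at most [m], remains. *)
Lemma subn_cap_add (m h a b : nat) :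
  (h <= m -> h <= (a + b).+1 -> (h - a) + (h - b) <= m.+1)%N.
Proof. lia. Qed.

(** * Divisors shared between values of a polynomial *)

Section SharedDivisors.
Variables (F : finFieldType) (m e : nat) (f : {poly {poly F}}).
Local Notation T := {poly_m F}.
Implicit Types (y z : T) (s : seq T).

(** One order charges [y] against the values after it, the other against those before it, so the two
    charges involve all other values. The prefix [s1] is the accumulator of the induction. *)
Lemma total_cost_rev_cat B s1 s2 :
  (forall u y v, s2 = u ++ y :: v ->
    cost e f v y + cost e f (rev (s1 ++ u)) y <= B)%N ->
  (total_cost e f s2 + total_cost e f (rev (s1 ++ s2))
    <= B * size s2 + total_cost e f (rev s1))%N.
Proof.
elim: s2 s1 => [|y s2 IHs] s1 le_B; first by rewrite cats0 muln0.
have := le_B [::] y s2 erefl; rewrite cats0 -cat_rcons /= mulnS => le_y.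
have := IHs (rcons s1 y); rewrite rev_rcons /= => IH.
have le_IH : forall u z v, s2 = u ++ z :: v ->
    (cost e f v z + cost e f (rev (rcons s1 y ++ u)) z <= B)%N.
  by move=> u z v s2E; have := le_B (y :: u) z v; rewrite s2E cat_rcons; apply.
have := IH le_IH; lia.
Qed.

Lemma dvdp_shared_part s y z : all (fun x => f.[val x] != 0) s -> z \in s ->
  common_part f y z %| shared_part f s y.
Proof.
rewrite /shared_part; elim: s => //= x s IHs /andP[_ s0].
rewrite inE => /predU1P[->|zs]; first exact: dvdp_lcml.
exact: dvdp_trans (IHs s0 zs) (dvdp_lcmr _ _).
Qed.

Lemma shared_part_dvd s y : all (fun x => f.[val x] != 0) s ->
  shared_part f s y %| \prod_(z <- s) (val y - val z).
Proof.
rewrite /shared_part; elim: s => [|x s IHs] /=; first by rewrite dvd1p.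
move=> /andP[fx0 s0]; rewrite big_cons dvdp_lcm ?common_part_neq0 //.
  by rewrite dvdp_mulr ?common_part_dvdr //= dvdp_mull ?IHs.
apply: foldr_lcmp_neq0; rewrite all_map; apply/allP => z /(allP s0) fz0.
exact: common_part_neq0.
Qed.

Lemma size_shared_part s y : all (fun x => f.[val x] != 0) s -> y \notin s ->
  ((size (shared_part f s y)).-1 <= size s * m)%N.
Proof.
move=> s0 ys; have nz : \prod_(z <- s) (val y - val z) != 0.
  rewrite prodf_seq_neq0; apply/allP => z zs /=; rewrite subr_eq0.
  by apply: contraNneq ys => /val_inj ->.
have := dvdp_leq nz (shared_part_dvd y s0).
suff : (size (\prod_(z <- s) (val y - val z))%R <= (size s * m).+1)%N.
  by move=> le1 le2; have := leq_trans le2 le1; case: (size (shared_part _ _ _)).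
elim: s {s0 ys nz} => [|x s IHs]; first by rewrite big_nil size_poly1.
rewrite big_cons; apply: leq_trans (size_polyMleq _ _) _.
have : (size (val y - val x)%R <= m)%N.
  by apply: leq_trans (size_polyD _ _) _; rewrite size_polyN geq_max !size_npoly.
rewrite /= mulSn; move: (size _) IHs; lia.
Qed.

Section OneValue.
Hypothesis e_gt0 : (0 < e)%N.
Variables (s1 s2 : seq T) (y : T).
Hypotheses (fy0 : f.[val y] != 0).
Hypothesis s0 : all (fun x => f.[val x] != 0) (s1 ++ s2).
Hypothesis y_notin : y \notin s1 ++ s2.
Hypothesis paired : forall p, irreducible_poly p -> p %| f.[val y] ->
  exists2 z, z \in s1 ++ s2 & (valp p f.[val y] <= e * valp p (val y - val z))%N.

(* A prime power dividing [f(y)] need only divide some [y - z] to the [e]-th root,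
   whence the exponent. *)
Lemma value_dvd_shared :
  f.[val y] %| (shared_part f s1 y * shared_part f s2 y) ^+ e.
Proof.
have [s10 s20] : all (fun x => f.[val x] != 0) s1 /\ all (fun x => f.[val x] != 0) s2.
  by move: s0; rewrite all_cat => /andP.
apply: dvdp_irredp_powers fy0 => p k irr dpk.
have lt1p : (1 < size p)%N by case: irr.
case: k dpk => [|k] dpk; first by rewrite expr0 dvd1p.
have dp : p %| f.[val y] by apply: dvdp_trans dpk; rewrite exprS dvdp_mulr.
have [z zs le_a] := paired irr dp.
have yz0 : val y - val z != 0.
  by rewrite subr_eq0; apply: contraNneq y_notin => /val_inj ->.
(* The power [p ^+ b] divides [f(y)] and [y - z], hence [f(z)] and the common part; and [e * b] is
   at least the valuation of [f(y)]. *)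
pose b := minn (valp p f.[val y]) (valp p (val y - val z)).
have dby : p ^+ b %| f.[val y] by rewrite valpP // geq_minl.
have dbyz : p ^+ b %| val y - val z by rewrite valpP // geq_minr.
have dbz : p ^+ b %| f.[val z].
  rewrite -(dvdp_subr _ dby); apply: dvdp_trans dbyz _; exact: dvdp_horner_sub.
have dbc : p ^+ b %| common_part f y z.
  by rewrite (eqp_dvdr _ (monic_part_eqp _)) dvdp_gcd dbz.
have dbs : p ^+ b %| shared_part f s1 y * shared_part f s2 y.
  move: zs; rewrite mem_cat => /orP[zs|zs]; [apply: dvdp_mulr|apply: dvdp_mull];
    by apply: dvdp_trans dbc _; apply: dvdp_shared_part.
apply: dvdp_trans (dvdp_exp2r e dbs); rewrite -exprM dvdp_exp2l //.
rewrite valpP // in dpk; apply: leq_trans dpk _.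
by rewrite /b /minn; case: ifP => _; [exact: leq_pmulr|rewrite mulnC].
Qed.

Lemma valdeg_shared :
  (valdeg f y <= ((size (shared_part f s1 y)).-1 + (size (shared_part f s2 y)).-1) * e)%N.
Proof.
have [s10 s20] : all (fun x => f.[val x] != 0) s1 /\ all (fun x => f.[val x] != 0) s2.
  by move: s0; rewrite all_cat => /andP.
have nz s : all (fun x => f.[val x] != 0) s -> shared_part f s y != 0.
  move=> s0'; apply: foldr_lcmp_neq0; rewrite all_map; apply/allP => z /(allP s0') fz0.
  exact: common_part_neq0.
have M0 : shared_part f s1 y * shared_part f s2 y != 0 by rewrite mulf_neq0 ?nz.
have := dvdp_leq (expf_neq0 e M0) value_dvd_shared.
rewrite /valdeg => le1; have : ((size f.[val y]).-1 <= (size ((shared_part f s1 y * shared_part f s2 y) ^+ e)%R).-1)%N.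
  by rewrite -!subn1 leq_sub2r.
rewrite size_exp size_mul ?nz //.
have := nz _ s10; have := nz _ s20; rewrite -!size_poly_gt0.
by case: (size (shared_part f s1 y)) (size (shared_part f s2 y)) => [|a] [|b] //= _ _; rewrite addnS.
Qed.

Lemma valdeg_le : (valdeg f y <= e * (size (s1 ++ s2) * m))%N.
Proof.
have [s10 s20] : all (fun x => f.[val x] != 0) s1 /\ all (fun x => f.[val x] != 0) s2.
  by move: s0; rewrite all_cat => /andP.
have [y1 y2] : y \notin s1 /\ y \notin s2.
  by apply/andP; rewrite -negb_or -mem_cat.
apply: leq_trans valdeg_shared _; rewrite mulnC leq_mul2l size_cat mulnDl.
by rewrite leq_add ?orbT ?size_shared_part.
Qed.

(** The degrees of the two shared parts add up to at least [valdeg f y %/ e], the degree radius of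
    the balls available to [y]. Both orders together thus cost one full choice of [y] instead of
    two, the extra unit coming from the [.+1] in the radius. *)
Lemma cost_add_le : (cost e f s1 y + cost e f s2 y <= m.+1)%N.
Proof.
apply: subn_cap_add; first exact: geq_minl.
rewrite (leq_trans (geq_minr _ _)) // ltnS.
by rewrite -(leq_pmul2r e_gt0) (leq_trans (leq_divM _ _)) ?valdeg_shared.
Qed.

End OneValue.
End SharedDivisors.

(** * Counting tuples whose polynomials share a given factor *)

Section CommonFactor.
Variables (F : finFieldType) (m r e tau : nat) (f : {poly {poly F}}) (c : 'I_r -> F).
Hypotheses (sf : size f = e.+1) (e_gt0 : (0 < e)%N) (c0 : forall i, c i != 0).
Hypothesis primitive_f : forall p : {poly F}, irreducible_poly p -> exists i, ~~ (p %| f`_i).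
Hypothesis tau_bound : forall u : {poly F}, u != 0 -> (size u <= (e * (r * m)).+1)%N ->
  (size (monic_divisors u) <= tau)%N.
Local Notation T := {poly_m F}.

(** The degree bound [e * (r * m)] holds because [f(y)] divides the [e]-th power of the shared
    parts, which divide products of at most [r] differences in all. Each of the [r] positions costs
    at most [m.+1] over the two orders. *)
Lemma card_common_factor (S : {set r.-tuple T}) :
  (forall t, t \in S -> uniq t /\ f %| recip_poly c (fun i => val (tnth t i))) ->
  (#|S| <= 2 * (e * ((e * (r * m)).+1 * tau ^ r)) ^ r * #|F| ^ (m.+1 * r)./2)%N.
Proof.
move=> Sf; apply: (card_cheap_tuples sf e_gt0 tau_bound) => t /Sf[ut dvf].
have tI : injective (fun i => val (tnth t i)) by move=> i j /val_inj/(tuple_uniqP _ ut).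
have [[d h] /= d0 dQ] := Pdiv.WeakIdomain.dvdpP _ _ dvf.
have ft0 i : f.[val (tnth t i)] != 0.
  have := recip_poly_neq0 (c0 i) tI; apply: contraNneq => fi0.
  have := congr1 (fun P => P.[val (tnth t i)]) dQ.
  rewrite hornerZ hornerM fi0 mulr0 => /eqP.
  by rewrite mulf_eq0 (negPf d0).
have allft0 s : {subset s <= t} -> all (fun x : T => f.[val x] != 0) s.
  by move=> st; apply/allP => x /st/tnthP[i ->].
have split_hyps s1 y s2 : tval t = s1 ++ y :: s2 ->
    [/\ f.[val y] != 0, all (fun x : T => f.[val x] != 0) (s1 ++ s2),
        y \notin s1 ++ s2, (size (s1 ++ s2) <= r)%N &
        forall p, irreducible_poly p -> p %| f.[val y] ->
          exists2 z, z \in s1 ++ s2 & (valp p f.[val y] <= e * valp p (val y - val z))%N].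
  move=> tE; have yt : y \in t by rewrite -[y \in t]/(y \in tval t) tE mem_cat mem_head orbT.
  have memE z : (z \in t) = (z == y) || (z \in s1 ++ s2).
    by rewrite -[z \in t]/(z \in tval t) tE !mem_cat inE orbCA.
  split.
  - by case/tnthP: yt => i ->.
  - by apply: allft0 => z zs; rewrite memE zs orbT.
  - by move: ut; rewrite tE -cat1s uniq_catCA /= => /andP[].
  - by rewrite -[X in (_ <= X)%N](size_tuple t) tE !size_cat /= leq_add2l.
  move=> p irr dp; have /tnthP[i yE] := yt.
  have lt1f : (1 < size f)%N by rewrite sf ltnS.
  rewrite yE in dp; have [j ne_ji le_v] :=
    recip_poly_valp c0 tI dvf irr lt1f (primitive_f irr) dp.
  exists (tnth t j); last by rewrite yE; rewrite sf in le_v.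
  have := mem_tnth j t; rewrite memE => /predU1P[yj|//].
  by move: ne_ji; rewrite -(inj_eq tI) /= yj yE eqxx.
split.
  apply/allP => y yt; have [s1 [s2 tE]] : exists s1 s2, tval t = s1 ++ y :: s2.
    by move: yt; rewrite -[y \in t]/(y \in tval t); case/splitPr => s1 s2; exists s1, s2.
  have [fy0 s0 ys szs paired] := split_hyps _ _ _ tE.
  rewrite /bounded_value fy0 /=; apply: leq_trans (valdeg_le e_gt0 fy0 s0 ys paired) _.
  by rewrite leq_mul2l leq_mul2r szs !orbT.
rewrite -{2}[tval t]cat0s -[X in (_ <= _ * X)%N](size_tuple t) -[leqRHS]addn0.
apply: total_cost_rev_cat => s1 y s2 tE.
have [fy0 s0 ys szs paired] := split_hyps _ _ _ tE.
apply: (cost_add_le e_gt0 fy0) => [|| p irr dp].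
- by rewrite all_cat all_rev andbC -all_cat.
- by rewrite mem_cat mem_rev orbC -mem_cat.
have [z zs le_v] := paired p irr dp; exists z => //.
by rewrite mem_cat mem_rev orbC -mem_cat.
Qed.

End CommonFactor.

(** * The divisor bound *)

Lemma ltn_factor (a b n : nat) : (1 < b -> (a + b).-1 < n.+1 -> a < n)%N.
Proof. lia. Qed.

Lemma pred_add_split (a b t : nat) : (0 < a -> t < b ->
  (a + b).-1.-1 = a.-1 + (b.-1 - t) + t)%N.
Proof. lia. Qed.

Section DivisorBound.
Variable F : finFieldType.
Implicit Types (p u v : {poly F}).
Local Notation ndiv u := (size (monic_divisors u)).

Lemma ndiv_le u (s : seq {poly F}) : u != 0 ->
  (forall v, v \is monic -> v %| u -> v \in s) -> (ndiv u <= size s)%N.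
Proof.
move=> u0 sub; apply: uniq_leq_size; first exact: monic_divisors_uniq.
by move=> v; rewrite monic_divisorsP // => /andP[]; apply: sub.
Qed.

(** Send [w] to the gcd of [w] and [u], made monic, and the cofactor. The cofactor divides [v],
    because [w] divides both [w * v] and [u * v], hence [v] times that gcd. *)
Lemma ndivM u v : u != 0 -> v != 0 -> (ndiv (u * v) <= ndiv u * ndiv v)%N.
Proof.
move=> u0 v0; have uv0 : u * v != 0 by rewrite mulf_neq0.
pose g w := monic_part (gcdp w u).
have dgw w : g w %| w by rewrite (eqp_dvdl _ (monic_part_eqp _)) dvdp_gcdl.
have dgu w : g w %| u by rewrite (eqp_dvdl _ (monic_part_eqp _)) dvdp_gcdr.
have gm w : g w \is monic by rewrite monic_part_monic // gcdp_eq0 negb_and u0 orbT.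
have gK w : g w * (w %/ g w) = w by rewrite mulrC divpK.
rewrite -(size_allpairs pair (monic_divisors u)) -(size_map (fun w => (g w, w %/ g w))).
apply: uniq_leq_size.
  rewrite map_inj_uniq ?monic_divisors_uniq // => w1 w2 [eqg eqq].
  by rewrite -(gK w1) -(gK w2) eqq eqg.
move=> _ /mapP[w + ->]; rewrite monic_divisorsP // => /andP[mw dw].
apply/allpairsP; exists (g w, w %/ g w).
split=> //=; rewrite monic_divisorsP // ?gm ?dgu //.
apply/andP; split; first by rewrite -(monicMl _ (gm w)) gK.
rewrite -(dvdp_mul2l _ _ (monic_neq0 (gm w))) gK mulrC.
rewrite (eqp_dvdr _ (eqp_mull v (monic_part_eqp _))) (eqp_dvdr _ (mulp_gcdr _ _ _)).
by rewrite dvdp_gcd dvdp_mull ?dvdpp //= mulrC.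
Qed.

Lemma ndiv_const u : u != 0 -> (size u <= 1)%N -> (ndiv u <= 1)%N.
Proof.
move=> u0 su; apply: (@ndiv_le _ [:: 1]) => // v mv dv.
have : (size v <= 1)%N by apply: leq_trans (dvdp_leq u0 dv) su.
by rewrite leq_eqVlt ltnS leqn0 size_poly_eq0 (negPf (monic_neq0 mv)) orbF
  size_poly_eq1 eqp_monic ?monic1 // inE.
Qed.

Lemma ndiv_irredp_exp p k : irreducible_poly p -> (ndiv (p ^+ k) <= k.+1)%N.
Proof.
move=> irr; have p0 := irredp_neq0 irr; have lt1p : (1 < size p)%N by case: irr.
rewrite -[X in (_ <= X)%N](size_mkseq (fun i => monic_part (p ^+ i)) k.+1).
apply: ndiv_le => [|v mv dv]; first by rewrite expf_neq0.
have v0 := monic_neq0 mv.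
have [w vE ndw] := valp_factor lt1p v0.
have w1 : w %= 1.
  have dw : w %| p ^+ k by apply: dvdp_trans dv; rewrite vE dvdp_mull.
  have cop : coprimep (p ^+ k) w by rewrite coprimep_expl // irreducible_poly_coprime.
  by rewrite -size_poly_eq1 -coprimepp (coprimep_dvdr dw).
have le_k : (valp p v <= k)%N.
  by rewrite -(dvdp_Pexp2l _ _ lt1p); apply: dvdp_trans dv; apply: valp_dvd.
apply/mapP; exists (valp p v); first by rewrite mem_iota.
apply/eqP; rewrite -eqp_monic ?monic_part_monic ?expf_neq0 //.
rewrite [X in _ %= X]/= (eqp_rtrans (monic_part_eqp _)) {1}vE.
by rewrite -[X in _ %= X]mulr1 eqp_mull.
Qed.

(** Every irreducible factor has degree at least [t], so there are at most [(size u).-1 %/ t] of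
    them, and each at most doubles the number of divisors. *)
Lemma ndiv_rough t u : (0 < t)%N -> u != 0 ->
  (forall p, irreducible_poly p -> p %| u -> (t < size p)%N) ->
  (ndiv u <= 2 ^ ((size u).-1 %/ t))%N.
Proof.
move=> t_gt0; have [n le_n] := ubnP (size u); elim: n u le_n => // n IHn u le_n u0 rough.
have [su|lt1u] := leqP (size u) 1.
  by apply: leq_trans (ndiv_const u0 su) _; rewrite expn_gt0.
have [p irr /dvdpP[v uE]] := irredp_dvd_exists lt1u.
have p0 := irredp_neq0 irr; have lt1p : (1 < size p)%N by case: irr.
have v0 : v != 0 by apply: contraNneq u0 => v0; rewrite uE v0 mul0r.
have lt_tp : (t < size p)%N by apply: rough => //; rewrite uE dvdp_mull.
have su : size u = (size v + size p).-1 by rewrite uE size_mul.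
have sv : (0 < size v)%N by rewrite size_poly_gt0.
have le_v : (ndiv v <= 2 ^ ((size v).-1 %/ t))%N.
  apply: IHn => //; last by move=> p' irr' dp'; apply: rough; rewrite // uE dvdp_mulr.
  by rewrite su in le_n; apply: ltn_factor le_n.
have le_p : (ndiv p <= 2)%N by have := ndiv_irredp_exp 1 irr; rewrite expr1.
rewrite [in X in (X <= _)%N]uE (leq_trans (ndivM v0 p0)) //.
apply: leq_trans (leq_mul le_v le_p) _; rewrite -expnSr leq_exp2l //.
rewrite su (pred_add_split sv lt_tp).
by rewrite divnDr ?dvdnn // divnn t_gt0 addn1 ltnS leq_div2r // leq_addr.
Qed.

(** Strip the full powers of the irreducibles in [L] one by one, each contributing at most [d.+1]
    divisors; what remains has only irreducible factors of size above [t]. *)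
Lemma ndiv_smooth_rough t d (L : seq {poly F}) u : (0 < t)%N -> u != 0 ->
  (size u <= d.+1)%N ->
  (forall p, irreducible_poly p -> p %| u -> (size p <= t)%N -> p \in L) ->
  (ndiv u <= d.+1 ^ size L * 2 ^ (d %/ t))%N.
Proof.
move=> t_gt0; elim: L u => [|p L IHL] u u0 su small.
  rewrite mul1n (@leq_trans (2 ^ ((size u).-1 %/ t))) //.
    by apply: ndiv_rough => // p irr dp; rewrite ltnNge; apply/negP => /(small _ irr dp).
  by rewrite leq_exp2l // leq_div2r // -ltnS (leq_trans _ su) // prednK // size_poly_gt0.
(* [L] may contain polynomials that are not irreducible, as it does when all those of size at most
   [t] are listed; such entries are skipped. *)
have [irr|nirr] := pselect (irreducible_poly p); last first.
  rewrite expnS -mulnA; apply: leq_trans (IHL u u0 su _) _ => [p' irr' dp' sp'|].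
    have := small p' irr' dp' sp'; rewrite inE => /predU1P[p'E|//].
    by case: nirr; rewrite -p'E.
  by rewrite leq_pmull.
have p0 := irredp_neq0 irr; have lt1p : (1 < size p)%N by case: irr.
have [v uE ndv] := valp_factor lt1p u0.
have v0 : v != 0 by apply: contraNneq u0 => v0; rewrite uE v0 mulr0.
have dvu : v %| u by rewrite uE dvdp_mull.
have le_val : (valp p u <= d)%N.
  have := dvdp_leq u0 (valp_dvd u lt1p); have pk0 := expf_neq0 (valp p u) p0.
  rewrite -size_poly_gt0 in pk0; rewrite -(prednK pk0) size_exp => le1.
  rewrite -ltnS; apply: leq_trans su; apply: leq_trans le1; rewrite ltnS.
  by rewrite leq_pmull // -ltnS prednK // ltnW.
rewrite [in X in (X <= _)%N]uE (leq_trans (ndivM (expf_neq0 _ p0) v0)) //.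
rewrite /= expnS -mulnA; apply: leq_mul.
  by apply: leq_trans (ndiv_irredp_exp _ irr) _.
apply: IHL => [//||p' irr' dp' sp'].
  by apply: leq_trans (dvdp_leq u0 dvu) su.
have := small p' irr' (dvdp_trans dp' dvu) sp'; rewrite inE => /predU1P[p'E|//].
by rewrite -p'E dp' in ndv.
Qed.

Lemma ndiv_le_smooth_rough t d u : (0 < t)%N -> u != 0 -> (size u <= d.+1)%N ->
  (ndiv u <= d.+1 ^ (#|F| ^ t) * 2 ^ (d %/ t))%N.
Proof.
move=> t_gt0 u0 su; pose L := [seq val p | p : {poly_t F} <- enum {: {poly_t F}}].
have <- : size L = (#|F| ^ t)%N by rewrite size_map -cardE card_npoly.
apply: ndiv_smooth_rough => // p _ _ sp.
by apply/mapP; exists (npolyp t p); rewrite ?mem_enum //= npolypK.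
Qed.

End DivisorBound.

(** * Common factors and resultants *)

(** Split [g] along a gcd with some [h] that is neither constant nor of full degree, and recurse. A
    piece that no [h] splits divides every [h] with which its gcd is nonconstant. *)
Lemma factor_list (R : idomainType) (g : {poly R}) : g != 0 ->
  exists L : seq {poly R}, [/\ (size L <= (size g).-1)%N,
    (forall f, f \in L -> (1 < size f <= size g)%N) &
    (forall h, (1 < size (gcdp g h))%N -> exists2 f, f \in L & f %| h)].
Proof.
have [n le_n] := ubnP (size g); elim: n g le_n => // n IHn g le_n g0.
have [sg|lt1g] := leqP (size g) 1.
  exists [::]; split=> // h lt1; have := leq_gcdpl h g0.
  by move=> le; have := leq_trans (leq_trans lt1 le) sg; rewrite ltnn.
have [[h /andP[lt1u ltug]]|nosplit] :=
    pselect (exists h, (1 < size (gcdp g h) < size g)%N); last first.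
  exists [:: g]; split=> [|f|h lt1]; first by rewrite -ltnS prednK // ltnW.
    by rewrite inE => /eqP ->; rewrite lt1g leqnn.
  exists g; first by rewrite mem_head.
  have : gcdp g h %= g.
    rewrite -dvdp_size_eqp ?dvdp_gcdl // eqn_leq leq_gcdpl //= leqNgt.
    by apply/negP => lt; apply: nosplit; exists h; rewrite lt1.
  by move/eqp_dvdl <-; apply: dvdp_gcdr.
set u := gcdp g h in lt1u ltug.
have [[c w] /= c0 gE] := Pdiv.WeakIdomain.dvdpP _ _ (dvdp_gcdl g h).
rewrite -/u in gE.
have u0 : u != 0 by rewrite -size_poly_gt0 ltnW.
have w0 : w != 0.
  apply: contraNneq g0 => w0; rewrite -size_poly_eq0 -(size_scale _ c0) gE w0 mul0r.
  by rewrite size_poly0.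
have sgE : size g = (size w + size u).-1.
  by rewrite -size_mul // -gE size_scale.
have w_gt0 : (0 < size w)%N by rewrite size_poly_gt0.
have [ltwg eqs] : (size w < size g)%N /\ ((size w).-1 + (size u).-1 = (size g).-1)%N.
  by rewrite sgE; move: (size w) (size u) w_gt0 lt1u => a b; lia.
have [Lu [sLu Lu2 Lu3]] := IHn u (leq_trans ltug le_n) u0.
have [Lw [sLw Lw2 Lw3]] := IHn w (leq_trans ltwg le_n) w0.
exists (Lw ++ Lu); split=> [|f|p lt1].
- by rewrite size_cat -eqs leq_add.
- rewrite mem_cat => /orP[/Lw2|/Lu2] /andP[-> le] /=; apply: leq_trans le _;
  exact: ltnW.
have : ~~ coprimep g p by rewrite /coprimep; case: (size _) lt1 => [|[]].
rewrite -(coprimepZl _ _ c0) gE coprimepMl negb_and.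
have lt1P (a : {poly R}) : a != 0 -> ~~ coprimep a p -> (1 < size (gcdp a p))%N.
  move=> a0; rewrite /coprimep; have : gcdp a p != 0 by rewrite gcdp_eq0 negb_and a0.
  by rewrite -size_poly_gt0; case: (size _) => [|[]].
by case/orP => /lt1P; [case/(_ w0)/Lw3|case/(_ u0)/Lu3] => f fL df;
  exists f; rewrite // mem_cat fL ?orbT.
Qed.

(** Dividing out an irreducible common to all coefficients lowers the degree of the leading
    coefficient, so the process stops. *)
Lemma primitive_factor (F : fieldType) (f : {poly {poly F}}) : f != 0 ->
  exists f1 : {poly {poly F}}, [/\ size f1 = size f, f1 %| f &
    forall p : {poly F}, irreducible_poly p -> exists i, ~~ (p %| f1`_i)].
Proof.
have [n le_n] := ubnP (size (lead_coef f)); elim: n f le_n => // n IHn f le_n f0.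
have [[p [irr dp]]|prim] :=
    pselect (exists p, irreducible_poly p /\ forall i, p %| f`_i); last first.
  exists f; split=> // p irr; apply: contrapT => nop; apply: prim; exists p.
  by split=> // i; apply: contrapT => /negP ndi; apply: nop; exists i.
have p0 := irredp_neq0 irr; have lt1p : (1 < size p)%N by case: irr.
pose f1 : {poly {poly F}} := \poly_(i < size f) (f`_i %/ p).
have fE : f = p *: f1.
  apply/polyP => i; rewrite coefZ coef_poly; case: ltnP => [_|/(nth_default 0) ->].
    by rewrite mulrC divpK.
  by rewrite mulr0.
have f10 : f1 != 0 by apply: contraNneq f0 => f10; rewrite fE f10 scaler0.
have lcf : lead_coef f = p * lead_coef f1 by rewrite {1}fE lead_coefZ.
have lt_lc : (size (lead_coef f1) < n)%N.
  rewrite lcf size_mul ?lead_coef_eq0 // in le_n.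
  by rewrite addnC in le_n; apply: ltn_factor lt1p le_n.
have [f2 [sf2 df2 prim]] := IHn f1 lt_lc f10.
exists f2; split=> //; first by rewrite sf2 fE size_scale.
by rewrite fE dvdpZr.
Qed.

Lemma weight_cancel (a X Y Z mu : nat) :
  (a + X * mu <= Y * mu -> Y <= Z + X -> a <= Z * mu)%N.
Proof.
move=> le1 le2; rewrite -(leq_add2r (X * mu)) -mulnDl (leq_trans le1) //.
by rewrite leq_mul2r le2 orbT.
Qed.

(** * Degree of the resultant of two isobaric polynomials *)

Section WeightedDegree.
Variables (F : fieldType) (mu : nat).
Implicit Types (P Q : {poly {poly F}}).

(* [P] is treated as if isobaric of weight [N], where the variable has weight 1
   and a coefficient of weight [w] has degree at most [w * mu]. *)
Definition wbound N j := if (j <= N)%N then ((N - j) * mu).+1 else 0%N.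
Definition weighted N P := forall j, (size (P`_j)%R <= wbound N j)%N.

Lemma weighted_sum (I : Type) (s : seq I) (A : pred I) (G : I -> {poly {poly F}}) N :
  (forall i, A i -> weighted N (G i)) -> weighted N (\sum_(i <- s | A i) G i).
Proof.
move=> wG j; rewrite coef_sum; apply: (big_ind (fun x : {poly F} => size x <= wbound N j)%N).
- by rewrite size_poly0.
- by move=> x y lex ley; apply: leq_trans (size_polyD _ _) _; rewrite geq_max lex.
by move=> i Ai; apply: wG.
Qed.

Lemma wboundM N M i j : (i <= j)%N -> (0 < wbound N i)%N -> (0 < wbound M (j - i))%N ->
  ((wbound N i + wbound M (j - i)).-1 <= wbound (N + M) j)%N.
Proof.
rewrite /wbound => le_ij; case: (leqP i N) => // le_iN _; case: (leqP (j - i) M) => // le_jM _.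
rewrite ifT; last by lia.
by rewrite addSn addnS /= -mulnDl ltnS leq_mul2r; apply/orP; right; lia.
Qed.

Lemma weightedM N M P Q : weighted N P -> weighted M Q -> weighted (N + M) (P * Q).
Proof.
move=> wP wQ j; rewrite coefM.
apply: (big_ind (fun x : {poly F} => size x <= wbound (N + M) j)%N).
- by rewrite size_poly0.
- by move=> x y lex ley; apply: leq_trans (size_polyD _ _) _; rewrite geq_max lex.
move=> i _; have [->|P0] := eqVneq P`_i 0; first by rewrite mul0r size_poly0.
have [->|Q0] := eqVneq Q`_(j - i) 0; first by rewrite mulr0 size_poly0.
rewrite size_mul //; rewrite -size_poly_gt0 in P0; rewrite -size_poly_gt0 in Q0.
have le_ij : (i <= j)%N by rewrite -ltnS.
apply: leq_trans (wboundM le_ij (leq_trans P0 (wP i)) (leq_trans Q0 (wQ _))).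
by rewrite -!subn1 leq_sub2r // leq_add.
Qed.

Lemma weightedC (c : F) : weighted 0 c%:P%:P.
Proof.
by case=> [|j]; rewrite coefC /= ?size_poly0 // /wbound subnn mul0n size_polyC leq_b1.
Qed.

Lemma weighted_XsubC (y : {poly F}) : (size y <= mu.+1)%N -> weighted 1 ('X - y%:P).
Proof.
move=> sy [|[|j]]; rewrite coefB coefX coefC /= ?subr0 ?sub0r ?size_polyN ?size_poly0 //.
- by rewrite /wbound /= subn0 mul1n.
- by rewrite size_poly1.
Qed.

Lemma weighted_prod (I : finType) (A : pred I) (G : I -> {poly {poly F}}) :
  (forall i, A i -> weighted 1 (G i)) -> weighted #|A| (\prod_(i | A i) G i).
Proof.
move=> wG; rewrite -sum1_card; elim/big_rec2: _ => [|i P n Ai wP].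
  exact: weightedC.
by apply: weightedM => //; apply: wG.
Qed.

Lemma weighted_recip_poly r (c : 'I_r -> F) (y : 'I_r -> {poly F}) :
  (forall i, size (y i) <= mu.+1)%N -> weighted r.-1 (recip_poly c y).
Proof.
move=> sy; apply: weighted_sum => i _; rewrite -mul_polyC -[r.-1]add0n.
apply: weightedM; first exact: weightedC.
have <- : #|[pred j | j != i]| = r.-1 by rewrite cardC1 card_ord.
by apply: weighted_prod => j _; apply: weighted_XsubC.
Qed.

Lemma weighted_size N P : weighted N P -> (size P <= N.+1)%N.
Proof.
move=> wP; apply/leq_sizeP => j lt_Nj; apply/eqP; rewrite -size_poly_leq0.
by apply: leq_trans (wP j) _; rewrite /wbound ifN // -ltnNge.
Qed.

Lemma pred_size_mul (u v : {poly F}) : ((size (u * v)%R).-1 <= (size u).-1 + (size v).-1)%N.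
Proof.
have [->|u0] := eqVneq u 0; first by rewrite mul0r size_poly0.
have [->|v0] := eqVneq v 0; first by rewrite mulr0 size_poly0.
rewrite size_mul //; rewrite -size_poly_gt0 in u0; rewrite -size_poly_gt0 in v0.
by move: (size u) (size v) u0 v0 => a b; lia.
Qed.

Lemma pred_size_prod (I : finType) (b : I -> {poly F}) :
  ((size (\prod_i b i)%R).-1 <= \sum_i (size (b i)).-1)%N.
Proof.
elim/big_rec2: _ => [|i n u _ le_n]; first by rewrite size_poly1.
by apply: leq_trans (pred_size_mul _ _) _; rewrite leq_add2l.
Qed.

Lemma sum_shifts d e N : (d <= N -> e <= N ->
  (e + d) * N + (\sum_(k < e) k + \sum_(k < d) k) <= N * N + \sum_(k < e + d) k)%N.
Proof.
move=> le_d le_e; rewrite big_split_ord /= big_split /= sum_nat_const card_ord.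
have : (0 <= (N - d) * (N - e))%N by [].
rewrite mulnBl !mulnBr; nia.
Qed.

(** A nonzero Sylvester entry in column [j] of a row shifted by [k] has weight [N + k - j]. Along a
    permutation the columns sum to a fixed total, so each term of the determinant has weight at most
    [N * N] by [sum_shifts]. *)
Lemma size_resultant N P Q : P != 0 -> Q != 0 -> weighted N P -> weighted N Q ->
  (size (resultant P Q) <= (N * N * mu).+1)%N.
Proof.
move=> P0 Q0 wP wQ; rewrite /resultant /determinant.
apply: (big_ind (fun x : {poly F} => size x <= (N * N * mu).+1)%N).
- by rewrite size_poly0.
- by move=> x y lex ley; apply: leq_trans (size_polyD _ _) _; rewrite geq_max lex.
move=> s _; rewrite -signr_odd mulr_sign; set u := \prod_i _.
pose sg : {perm 'I_((size Q).-1 + (size P).-1)} := s.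
suff : (size u <= (N * N * mu).+1)%N by case: odd; rewrite ?size_polyN.
have [->|u0] := eqVneq u 0; first by rewrite size_poly0.
have [sP sQ] := (weighted_size wP, weighted_size wQ).
pose off (i : 'I_((size Q).-1 + (size P).-1)) : nat :=
  match fintype.split i with inl k => k | inr k => k end.
have entry i : ((size (Sylvester_mx P Q i (sg i))%R).-1 + sg i * mu <= (N + off i) * mu)%N.
  have /prodf_neq0/(_ i isT) := u0; rewrite Sylvester_mxE /off.
  have coef_entry G (k : nat) : weighted N G ->
      G`_(sg i - k)%N *+ (k <= sg i)%N != 0 ->
      ((size (G`_(sg i - k)%N *+ (k <= sg i)%N)%R).-1 + sg i * mu <= (N + k) * mu)%N.
    move=> wG; case: (leqP k (sg i)) => [le_k|_]; last by rewrite mulr0n eqxx.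
    rewrite mulr1n -size_poly_gt0 => G0; have := wG (sg i - k)%N.
    rewrite /wbound; case: (leqP (sg i - k) N) => [le_N le_G|_]; last by rewrite leqNgt G0.
    have le_G' : ((size (G`_(sg i - k)%N)%R).-1 <= (N - (sg i - k)) * mu)%N.
      by rewrite -ltnS (leq_trans _ le_G) // prednK.
    apply: leq_trans (leq_add le_G' (leqnn _)) _; rewrite -mulnDl leq_mul2r.
    by apply/orP; right; lia.
  by case: (fintype.split i) => k; apply: coef_entry.
have : ((size u).-1 + \sum_i sg i * mu <= \sum_i (N + off i) * mu)%N.
  apply: leq_trans (leq_add (pred_size_prod _) (leqnn _)) _.
  by rewrite -big_split /=; apply: leq_sum => i _; apply: entry.
rewrite -!big_distrl /= big_split /= sum_nat_const card_ord.
have -> : (\sum_i (sg i : nat) = \sum_(i < (size Q).-1 + (size P).-1) i)%N.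
  by rewrite [RHS](reindex_inj (@perm_inj _ sg)).
have -> : (\sum_i off i = \sum_(k < (size Q).-1) k + \sum_(k < (size P).-1) k)%N.
  by rewrite big_split_ord /=; congr addn; apply: eq_bigr => k _;
    rewrite /off (unsplitK (inl k), unsplitK (inr k)).
move=> le_deg; rewrite -size_poly_gt0 in u0; rewrite -(prednK u0) ltnS.
apply: weight_cancel le_deg (sum_shifts _ _); by rewrite -subn1 leq_subLR add1n.
Qed.

End WeightedDegree.

(** * All reciprocal polynomials share a factor with a fixed one *)

Section Pigeonhole.
Variables (F : finFieldType) (m r tau : nat) (psi x0 : {poly F}) (c : 'I_r -> F).
Hypotheses (irr : irreducible_poly psi) (r_gt0 : (0 < r)%N) (c0 : forall i, c i != 0).
Hypothesis m_gt0 : (0 < m)%N.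
Hypothesis small : (r.-1 * r.-1 * m.-1 < (size psi).-1)%N.
Hypothesis tau_bound : forall u : {poly F}, u != 0 -> (size u <= (r * (r * m)).+1)%N ->
  (size (monic_divisors u) <= tau)%N.
Local Notation T := {poly_m F}.
Local Notation recip t := (recip_poly c (fun i => val (tnth t i))).

Lemma recip_tuple_neq0 (t : r.-tuple T) : uniq t -> recip t != 0.
Proof.
move=> ut; have tI : injective (fun i => val (tnth t i)).
  by move=> i j /val_inj/(tuple_uniqP _ ut).
by have := recip_poly_neq0 (c0 (Ordinal r_gt0)) tI; apply: contraNneq => ->; rewrite horner0.
Qed.

Lemma weighted_recip_tuple (t : r.-tuple T) : weighted m.-1 r.-1 (recip t).
Proof. by apply: weighted_recip_poly => i; rewrite prednK ?size_npoly. Qed.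

Lemma size_recip_gt1 (t : r.-tuple T) : uniq t -> psi %| (recip t).[x0] ->
  (1 < size (recip t))%N.
Proof.
move=> ut dpsi; rewrite ltnNge; apply/negP => /size1_polyC recE.
have rec0 := recip_tuple_neq0 ut; rewrite recE polyC_eq0 in rec0.
rewrite recE hornerC in dpsi; have := dvdp_leq rec0 dpsi.
have := weighted_recip_tuple t 0; rewrite /wbound /= subn0 => le1 le2.
have := leq_trans le2 le1; have psi_gt0 : (0 < size psi)%N by rewrite size_poly_gt0 irredp_neq0.
rewrite -(prednK psi_gt0) ltnS leqNgt => /negP; apply; apply: leq_ltn_trans small.
by rewrite leq_mul2r; apply/orP; right; case: r.-1 => // k; rewrite leq_pmulr.
Qed.

(** The resultant is a combination of both polynomials, so evaluation at [x0] shows that [psi]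
    divides it. Its degree is at most [r.-1 * r.-1 * m.-1], below that of [psi], so it vanishes. *)
Lemma recip_common_factor (t s : r.-tuple T) : uniq t -> uniq s ->
  psi %| (recip t).[x0] -> psi %| (recip s).[x0] ->
  (1 < size (gcdp (recip t) (recip s)))%N.
Proof.
move=> ut us dt ds; rewrite -resultant_eq0; apply: contraT => res0.
have [uv _ resE] := resultant_in_ideal (size_recip_gt1 ut dt) (size_recip_gt1 us ds).
have dres : psi %| resultant (recip t) (recip s).
  rewrite -(hornerC (resultant _ _) x0) resE hornerD !hornerM.
  by rewrite dvdp_add // dvdp_mull.
have := dvdp_leq res0 dres.
have := size_resultant (recip_tuple_neq0 ut) (recip_tuple_neq0 us)
  (weighted_recip_tuple t) (weighted_recip_tuple s).
move=> le1 le2; have := leq_trans le2 le1.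
have psi_gt0 : (0 < size psi)%N by rewrite size_poly_gt0 irredp_neq0.
by rewrite -(prednK psi_gt0) ltnS leqNgt small.
Qed.

Lemma card_recip_tuples (S : {set r.-tuple T}) :
  (forall t, t \in S -> uniq t /\ psi %| (recip t).[x0]) ->
  (#|S| <= r * (2 * (r * ((r * (r * m)).+1 * tau ^ r)) ^ r * #|F| ^ (m.+1 * r)./2))%N.
Proof.
move=> SP; have [->|[t tS]] := set_0Vmem S; first by rewrite cards0.
have [ut dt] := SP t tS; have rec0 := recip_tuple_neq0 ut.
have [L [sL Lsize Ldvd]] := factor_list rec0.
have srec := weighted_size (weighted_recip_tuple t); rewrite prednK // in srec.
set B := (X in (_ <= r * X)%N).
pose Sf f := [set s in S | f %| recip s].
have cover : {subset S <= \bigcup_(f <- L) Sf f}.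
  move=> s sS; have [us ds] := SP s sS.
  have [f fL df] := Ldvd _ (recip_common_factor ut us dt ds).
  by rewrite (big_rem f fL) !inE sS df.
apply: leq_trans (subset_leq_card (introT fintype.subsetP cover)) _.
apply: (@leq_trans (\sum_(f <- L) B)); last first.
  rewrite big_const_seq count_predT iter_addn_0 mulnC leq_mul2r.
  by rewrite (leq_trans sL) ?orbT // (leq_trans (leq_pred _)).
elim: L Lsize {sL Ldvd cover} => [|f L IHL] Lsize; first by rewrite !big_nil cards0.
rewrite !big_cons (leq_trans (leq_card_setU _ _)) // leq_add ?IHL //; last first.
  by move=> g gL; apply: Lsize; rewrite inE gL orbT.
have /andP[lt1f lef] := Lsize f (mem_head _ _).
have f0 : f != 0 by rewrite -size_poly_gt0 ltnW.
(* The Newton polygon argument requires, for each irreducible, a coefficient it does not divide. *)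
have [g [sg dg prim]] := primitive_factor f0.
pose e := (size g).-1; have sge : size g = e.+1 by rewrite /e sg prednK // ltnW.
have e_gt0 : (0 < e)%N by rewrite -ltnS -sge sg.
have le_er : (e <= r)%N by rewrite -ltnS -sge sg (leq_trans lef) // (leq_trans srec).
have tau_e (u : {poly F}) : u != 0 -> (size u <= (e * (r * m)).+1)%N ->
    (size (monic_divisors u) <= tau)%N.
  by move=> u0 su; apply: tau_bound => //; rewrite (leq_trans su) // ltnS leq_mul.
apply: leq_trans (card_common_factor sge e_gt0 c0 prim tau_e _) _.
  move=> s; rewrite inE => /andP[sS df]; have [us _] := SP s sS.
  by split=> //; apply: dvdp_trans dg df.
rewrite leq_mul2r leq_mul2l /= leq_exp2r // leq_mul ?orbT //.
by rewrite leq_mul2r ltnS leq_mul ?orbT.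
Qed.

End Pigeonhole.

(** * From congruences of reciprocals to divisibility by [psi] *)

Section Residues.
Variables (F : finFieldType) (psi : {poly F}) (hpsi : monic_irreducible_poly psi).
Local Notation K := {poly %/ psi with hpsi}.
Local Notation res := (residue hpsi).

Definition residue_rmorphism : {rmorphism {poly F} -> K} := in_qpoly psi.

Lemma residueE p : res p = residue_rmorphism p. Proof. by []. Qed.

Lemma residue_eq0 p : (res p == 0) = (psi %| p).
Proof.
have mpsi := mk_monicE hpsi; have monpsi := monic_mk_monic psi.
by rewrite -val_eqE /= -Pdiv.IdomainMonic.modpE // mpsi.
Qed.

(** Clear denominators. The signs match the factors ['X - y j], whose values at [- gamma] are
    [- (y j + gamma)]. *)
Lemma recip_residue (K' : fieldType) (I : finType) (b a : I -> K') :
  (forall i, a i != 0) -> \sum_i b i * (a i)^-1 = 0 ->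
  \sum_i b i * \prod_(j | j != i) - a j = 0.
Proof.
move=> a0 sum0; have -> : \sum_i b i * \prod_(j | j != i) - a j =
    (- \prod_j - a j) * \sum_i b i * (a i)^-1; last by rewrite sum0 mulr0.
rewrite big_distrr; apply: eq_bigr => i _ /=; rewrite [in RHS](bigD1 i) //=.
by field; exact: a0.
Qed.

Lemma psi_dvd_recip_poly n (c : 'I_n -> F) (y : 'I_n -> {poly F}) gamma :
  (forall i, res (y i + gamma) != 0) ->
  \sum_i res (c i)%:P * (res (y i + gamma))^-1 = 0 ->
  psi %| (recip_poly c y).[- gamma].
Proof.
move=> y0 /(recip_residue y0) sum0.
rewrite -residue_eq0 /recip_poly horner_sum residueE rmorph_sum /= -[X in _ == X]sum0.
apply/eqP; apply: eq_bigr => i _; rewrite hornerZ horner_prod rmorphM rmorph_prod.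
congr (_ * _); apply: eq_bigr => j _.
by rewrite hornerXsubC -opprD addrC rmorphN.
Qed.

End Residues.

(** * Grouping equal variables *)

Section Representatives.
Variables (n : nat) (T : eqType).
Implicit Types x : {ffun 'I_n -> T}.

(** Encodes which entries of [x] coincide as a self-map of the indices, of which there are [n ^ n];
    equal entries get the same representative because the choice depends on the value only. *)
Definition representative x : {ffun 'I_n -> 'I_n} :=
  [ffun i => odflt i [pick j | x j == x i]].

Lemma representativeK x i : x (representative x i) = x i.
Proof. by rewrite ffunE; case: pickP => [j /eqP|]. Qed.

Lemma eq_representative x i j :
  (representative x i == representative x j) = (x i == x j).
Proof.
apply/eqP/eqP => [rE|xE]; first by rewrite -(representativeK x i) rE representativeK.
rewrite !ffunE; rewrite (eq_pick (Q := fun l => x l == x j)) => [|l]; last by rewrite xE.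
by case: pickP => [//|/(_ j)]; rewrite eqxx.
Qed.

Lemma representative_idem x i : representative x (representative x i) = representative x i.
Proof. by apply/eqP; rewrite eq_representative representativeK. Qed.
End Representatives.

Section Patterns.
Variables (F : finFieldType) (psi : {poly F}) (hpsi : monic_irreducible_poly psi).
Variables (k m : nat) (gamma : {poly F}) (rho : {ffun 'I_(k + k) -> 'I_(k + k)}).
Hypotheses (rhoK : forall i, rho (rho i) = rho i).
Local Notation T := {poly_m F}.
Local Notation n := (k + k)%N.

Definition side (j : 'I_n) : F := if fintype.split j is inl _ then 1 else -1.
(** Taken in [F], so a class may also cancel because of the characteristic. *)
Definition class_coef (i : 'I_n) : F := \sum_(j | rho j == i) side j.
Definition proper_classes := [set i | (rho i == i) && (class_coef i != 0)].
Definition free_classes := [set i | (rho i == i) && (class_coef i == 0)].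
Local Notation r := #|proper_classes|.

Definition proper_values (x : {ffun 'I_n -> T}) : r.-tuple T :=
  [tuple x (enum_val l) | l < r].
Definition free_values (x : {ffun 'I_n -> T}) : {ffun 'I_#|free_classes| -> T} :=
  [ffun l => x (enum_val l)].

Lemma side_neq0 j : side j != 0.
Proof. by rewrite /side; case: fintype.split => _; rewrite ?oppr_eq0 oner_eq0. Qed.

(** A single sign is nonzero, so a class whose coefficient vanishes has at least two members. *)
Lemma card_classes : (r + 2 * #|free_classes| <= n)%N.
Proof.
rewrite -[leqRHS]card_ord -[leqRHS]sum1_card.
rewrite [X in (_ <= X)%N](partition_big rho (fun i => rho i == i)) => [|j _]; last by rewrite rhoK.
rewrite (bigID (fun i => class_coef i != 0)) /= leq_add //.
  rewrite -sum1_card /proper_classes (eq_bigl (fun i => (rho i == i) && (class_coef i != 0))); last first.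
    by move=> i; rewrite inE.
  apply: leq_sum => i /andP[/eqP rhoi _].
  by rewrite (bigD1 i) ?rhoi.
rewrite mulnC -sum_nat_const (eq_bigl (fun i => (rho i == i) && ~~ (class_coef i != 0))); last first.
  by move=> i; rewrite inE negbK.
apply: leq_sum => i /andP[/eqP rhoi]; rewrite negbK => coef0.
have [j /andP[rhoj ne_ji]] : exists j, (rho j == i) && (j != i).
  apply/existsP; apply: contraTT coef0 => /existsPn noj; rewrite /class_coef (bigD1 i) ?rhoi //=.
  rewrite big1 ?addr0 ?side_neq0 // => j /andP[rhoj ne_ji].
  by have := noj j; rewrite rhoj ne_ji.
by rewrite (bigD1 i) ?rhoi //= (bigD1 j) ?rhoj.
Qed.

Local Notation sol := (reciprocal_solutions hpsi k gamma m).
Definition pattern_solutions := [set x in sol | representative x == rho].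

Lemma values_inj :
  {in pattern_solutions &, injective (fun x => (proper_values x, free_values x))}.
Proof.
move=> x z; rewrite !inE => /andP[_ /eqP rx] /andP[_ /eqP rz] eqv.
have pE : proper_values x = proper_values z := congr1 fst eqv.
have fE : free_values x = free_values z := congr1 snd eqv.
apply/ffunP => i; rewrite -(representativeK x) -(representativeK z) rx rz.
have [coef0|coef0] := eqVneq (class_coef (rho i)) 0.
  have fi : rho i \in free_classes by rewrite inE rhoK eqxx coef0 /=.
  have /ffunP/(_ (enum_rank_in fi (rho i))) := fE.
  by rewrite !ffunE enum_rankK_in.
have pi : rho i \in proper_classes by rewrite inE rhoK eqxx coef0.
have := congr1 (fun t => tnth t (enum_rank_in pi (rho i))) pE.
by rewrite !tnth_mktuple enum_rankK_in.
Qed.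

(** Write the congruence as one signed sum and group it by classes: those with zero coefficient drop
    out, and the remaining values are distinct. *)
Lemma proper_values_spec x : x \in pattern_solutions ->
  uniq (proper_values x) /\
  psi %| (recip_poly (fun l => class_coef (enum_val (A := proper_classes) l))
            (fun l => val (tnth (proper_values x) l))).[- gamma].
Proof.
rewrite !inE => /andP[/andP[/forallP nz /eqP eqsum] /eqP rx].
have xI i j : i \in proper_classes -> j \in proper_classes -> x i = x j -> i = j.
  rewrite !inE => /andP[/eqP ri _] /andP[/eqP rj _] /eqP.
  by rewrite -eq_representative rx ri rj => /eqP.
split.
  apply/tuple_uniqP => l1 l2; rewrite !tnth_mktuple => /xI xE.
  by apply: enum_val_inj; apply: xE; apply: enum_valP.
apply: (psi_dvd_recip_poly (hpsi := hpsi)) => [l|].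
  by rewrite residue_eq0 tnth_mktuple nz.
pose a (i : 'I_n) := (residue hpsi (val (x i) + gamma))^-1.
pose rs := residue_rmorphism hpsi.
under eq_bigr do rewrite tnth_mktuple.
rewrite -(big_enum_val (fun i => residue hpsi (class_coef i)%:P * a i)) /=.
have : \sum_j rs (side j)%:P * a j = 0.
  rewrite big_split_ord /=; apply/eqP; rewrite -[X in _ + X]opprK subr_eq0 -sumrN.
  apply/eqP; transitivity (\sum_(i < k) a (lshift k i)).
    by apply: eq_bigr => i _; rewrite /side (unsplitK (inl i)) rmorph1 mul1r.
  rewrite /a eqsum; apply: eq_bigr => i _.
  by rewrite /side (unsplitK (inr i)) polyCN rmorphN rmorph1 mulN1r opprK.
rewrite (partition_big rho (fun i => rho i == i)) => [|j _]; last by rewrite rhoK.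
move=> sum0; rewrite -[RHS]sum0 [RHS](bigID (fun i => class_coef i != 0)) /=.
have classE i : rho i == i -> \sum_(j | rho j == i) rs (side j)%:P * a j =
    rs (class_coef i)%:P * a i.
  move=> /eqP ri; rewrite /class_coef !rmorph_sum big_distrl /=.
  apply: eq_bigr => j /eqP rj; congr (_ * _); rewrite /a; congr (residue _ (val _ + _))^-1.
  by apply/eqP; rewrite -eq_representative rx ri rj.
rewrite [X in _ = _ + X]big1 ?addr0 => [|i /andP[ri]]; last first.
  by rewrite negbK => /eqP coef0; rewrite classE // coef0 rmorph0 mul0r.
rewrite (eq_bigl (fun i => (rho i == i) && (class_coef i != 0))) => [|i]; last by rewrite inE.
by apply: eq_bigr => i /andP[ri _]; rewrite classE.
Qed.

End Patterns.

(** * Bound on the number of solutions *)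

Section SolutionBound.
Variables (F : finFieldType) (psi : {poly F}) (hpsi : monic_irreducible_poly psi).
Variables (k m tau : nat) (gamma : {poly F}).
Local Notation n := (k + k)%N.
Hypotheses (k_gt0 : (0 < k)%N) (m_gt0 : (0 < m)%N).
Hypothesis small : (n.-1 * n.-1 * m.-1 < (size psi).-1)%N.
Hypothesis tau_bound : forall u : {poly F}, u != 0 -> (size u <= (n * (n * m)).+1)%N ->
  (size (monic_divisors u) <= tau)%N.
Local Notation C := (n * (2 * (n * ((n * (n * m)).+1 * tau ^ n)) ^ n))%N.

Lemma card_pattern_solutions (rho : {ffun 'I_n -> 'I_n}) :
  (#|pattern_solutions hpsi m gamma rho| <= C * #|F| ^ (k * m.+1))%N.
Proof.
have tau1 := tau_gt0 tau_bound.
have n_gt0 : (0 < n)%N by rewrite addn_gt0 k_gt0.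
have q_gt0 : (0 < #|F|)%N by apply/card_gt0P; exists 0.
have [->|[x xP]] := set_0Vmem (pattern_solutions hpsi m gamma rho); first by rewrite cards0.
have rhoK i : rho (rho i) = rho i.
  by move: xP; rewrite inE => /andP[_ /eqP <-]; apply: representative_idem.
set r := #|proper_classes F rho|; set z := #|free_classes F rho|.
have rz : (r + 2 * z <= n)%N by apply: card_classes.
have le_rn : (r <= n)%N by apply: leq_trans rz; apply: leq_addr.
pose S := [set proper_values rho x | x in pattern_solutions hpsi m gamma rho].
have SP t : t \in S -> uniq t /\ psi %|
    (recip_poly (fun l => class_coef F rho (enum_val (A := proper_classes F rho) l))
      (fun l => val (tnth t l))).[- gamma].
  by case/imsetP => y yP ->; apply: (proper_values_spec rhoK yP).
have le_S : (#|S| <= C * #|F| ^ (m.+1 * r)./2)%N.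
  have [r0|r_gt0] := posnP r.
    have : (#|S| <= 1)%N.
      by apply: leq_trans (max_card _) _; rewrite card_tuple -/r r0.
    move/leq_trans; apply; rewrite r0 muln0 expn0 muln1.
    by rewrite !muln_gt0 n_gt0 expn_gt0 !muln_gt0 n_gt0 expn_gt0 tau1.
  have le1 (a b c d e : nat) : (a <= b)%N -> (c <= d)%N -> (a * (2 * c * e) <= b * (2 * d) * e)%N.
    by move=> ab cd; rewrite -!mulnA leq_mul // leq_mul // leq_mul.
  apply: leq_trans (@card_recip_tuples F m r tau psi (- gamma) _ hpsi.1 r_gt0 _ m_gt0 _ _ S SP) _.
  - by move=> i; have := enum_valP i; rewrite inE => /andP[].
  - apply: leq_ltn_trans small; rewrite leq_mul2r; apply/orP; right.
    by rewrite leq_mul // -!subn1 leq_sub2r.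
  - move=> u u0 su; apply: tau_bound => //; apply: leq_trans su _.
    by rewrite ltnS leq_mul // leq_mul2r le_rn orbT.
  apply: le1 => //; apply: (@leq_trans ((n * ((n * (n * m)).+1 * tau ^ n)) ^ r)).
    rewrite leq_exp2r // leq_mul // leq_mul //; last exact: leq_pexp2l.
    by rewrite ltnS leq_mul // leq_mul2r le_rn orbT.
  by apply: leq_pexp2l => //; rewrite !muln_gt0 n_gt0 expn_gt0 tau1.
have : (#|pattern_solutions hpsi m gamma rho| <= #|S| * #|{ffun 'I_z -> {poly_m F}}|)%N.
  rewrite -(card_in_imset (values_inj rhoK)) -[X in (_ <= _ * X)%N]cardsT -cardsX.
  apply: subset_leq_card; apply/fintype.subsetP => _ /imsetP[y yP ->].
  by rewrite !inE /= andbT; apply: imset_f.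
move/leq_trans; apply; apply: leq_trans (leq_mul le_S (leqnn _)) _.
rewrite card_ffun card_ord card_npoly -expnM -mulnA -expnD leq_mul2l.
apply/orP; right; apply: leq_pexp2l => //.
(* Twice the exponent is at most [m.+1 * r + 2 * (m * z)], hence at most [m.+1 * (r + 2 * z)], and
   [r + 2 * z <= k + k]. *)
rewrite -leq_double doubleD; have := odd_double_half (m.+1 * r).
rewrite -!mul2n; nia.
Qed.

Lemma Nsol_le : (Nsol hpsi k gamma m <= n ^ n * (C * #|F| ^ (k * m.+1)))%N.
Proof.
rewrite /Nsol -sum1_card (partition_big (@representative _ _) predT) //=.
have -> : (n ^ n = \sum_(rho : {ffun 'I_n -> 'I_n}) 1)%N.
  by rewrite sum1_card card_ffun !card_ord.
rewrite big_distrl /=; apply: leq_sum => rho _; rewrite mul1n.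
apply: leq_trans (card_pattern_solutions rho); rewrite sum1dep_card.
by apply: subset_leq_card; apply/fintype.subsetP => x; rewrite !inE.
Qed.

End SolutionBound.

Lemma Nsol_trivial (F : finFieldType) (psi : {poly F}) (hpsi : monic_irreducible_poly psi)
    (k m : nat) gamma :
  (Nsol hpsi k gamma m <= #|F| ^ (m * (k + k)))%N.
Proof.
by apply: leq_trans (max_card _) _; rewrite card_ffun card_ord card_npoly expnM.
Qed.

(** * Asymptotics *)

Lemma leq_expl a b e : (a <= b -> a ^ e <= b ^ e)%N.
Proof. by case: e => // e; rewrite leq_exp2r. Qed.

(** With [j = m %/ e.+1] one has [m <= e.+1 * 2 ^ j], so the left side is at most
    [A1 * 2 ^ (j * e)]; a further factor [2 ^ j] absorbs [A1]. *)
Lemma poly_le_exp2 (A B e : nat) :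
  exists M, forall m, (M <= m -> A * (B * m).+1 ^ e <= 2 ^ m)%N.
Proof.
pose A1 := (A * (B.+1 * e.+1) ^ e)%N; exists (e.+1 * A1.+1)%N => m le_m.
set j := (m %/ e.+1)%N; have m_gt0 : (0 < m)%N by apply: leq_trans le_m; rewrite muln_gt0.
have le_j : (A1 < j)%N by rewrite /j leq_divRL // mulnC.
have lt_m : (m <= e.+1 * 2 ^ j)%N.
  apply: (@leq_trans (e.+1 * j.+1)); last by rewrite leq_mul2l ltn_expl ?orbT.
  by rewrite mulnC ltnW // ltn_ceil.
have le1 : ((B * m).+1 ^ e <= (B.+1 * e.+1) ^ e * 2 ^ (j * e))%N.
  rewrite expnM -expnMn leq_expl // (@leq_trans (B.+1 * m)) //.
    by rewrite mulSn -addn1 addnC leq_add2r.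
  by rewrite -mulnA leq_mul2l lt_m orbT.
apply: (@leq_trans (A1 * 2 ^ (j * e))); first by rewrite -mulnA leq_mul2l le1 orbT.
apply: (@leq_trans (2 ^ j * 2 ^ (j * e))).
  by rewrite leq_mul2r (ltnW (ltn_trans le_j (ltn_expl _ _))) ?orbT.
by rewrite -expnD -mulnS leq_exp2l // leq_divM.
Qed.

(** Uniformity in the field comes from two cases. If [#|F| >= 2 ^ (D * w)], the trivial bound
    [2 ^ (D * m)] on the number of divisors suffices. Otherwise [#|F|] is bounded: the smooth part
    is polynomial in [m], and the rough part costs at most [2 ^ m] after the [w]-th power because
    [t > D * w]. *)
Lemma divisor_bound (n w : nat) : exists M, forall m, (M <= m)%N -> forall F : finFieldType,
  exists tau, (forall u : {poly F}, u != 0 -> (size u <= (n * (n * m)).+1)%N ->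
    (size (monic_divisors u) <= tau)%N) /\ (tau ^ w <= #|F| ^ (2 * m))%N.
Proof.
pose D := (n * n)%N; pose t := (D * w).+1; pose Q := (2 ^ (D * w))%N.
have [M le_M] := poly_le_exp2 1 D (Q ^ t * w).
exists M => m le_m F; have q_gt1 : (1 < #|F|)%N by apply: finNzRing_gt1.
have [le_Q|lt_Q] := leqP Q #|F|.
  exists (2 ^ (D * m))%N; split=> [u u0 su|].
    apply: leq_trans (@ndiv_rough _ 1 u isT u0 _) _ => [p [] //|].
    by rewrite divn1 leq_exp2l // -ltnS prednK ?size_poly_gt0 // -mulnA.
  rewrite -expnM mulnAC expnM (@leq_trans (#|F| ^ m)) ?leq_expl //.
  by rewrite leq_exp2l // leq_pmull.
exists ((D * m).+1 ^ (#|F| ^ t) * 2 ^ (D * m %/ t))%N; split=> [u u0 su|].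
  by apply: ndiv_le_smooth_rough; rewrite // /D -mulnA.
rewrite expnMn -!expnM mul2n -addnn expnD leq_mul //.
  apply: (@leq_trans (2 ^ m)); last exact: leq_expl.
  apply: leq_trans (le_M m le_m); rewrite mul1n leq_pexp2l // leq_mul2r.
  by rewrite leq_expl ?orbT // ltnW.
apply: (@leq_trans (2 ^ m)); last exact: leq_expl.
rewrite leq_exp2l // -(@leq_pmul2r t) // mulnAC (leq_trans (leq_mul (leq_divM _ _) (leqnn w))) //.
by rewrite mulnAC mulnC leq_mul2l leqnSn orbT.
Qed.

(** This is the bound with exponent [(k + 1 / s) * m], raised to the power [s] to stay among
    integers. The threshold [M] is chosen before the field, [psi] and [gamma]. *)
Lemma Nsol_growth (k s : nat) : (0 < k)%N ->
  exists M, forall m, (M <= m)%N -> (0 < m)%N ->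
  forall (F : finFieldType) (psi : {poly F}) (hpsi : monic_irreducible_poly psi) gamma,
  ((k + k).-1 * (k + k).-1 * m.-1 < (size psi).-1)%N ->
  (Nsol hpsi k gamma m ^ s <= #|F| ^ (s * (k * m) + m))%N.
Proof.
move=> k_gt0; pose n := (k + k)%N; pose A := (n ^ n * (n * (2 * n ^ n)))%N.
have [M1 le_M1] := poly_le_exp2 (A ^ (s * 4)) (n * n) (n * (s * 4)).
have [M2 le_M2] := divisor_bound n (n * n * (s * 4)).
exists (M1 + M2 + k * (s * 4))%N => m le_m m_gt0 F psi hpsi gamma small.
have [|tau [tauP tau_le]] := le_M2 m _ F; first by lia.
have q_gt1 : (1 < #|F|)%N by apply: finNzRing_gt1.
have := Nsol_le hpsi gamma k_gt0 m_gt0 small tauP; rewrite -/n.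
set N := Nsol _ _ _ _ => le_N; set q := #|F| in tau_le q_gt1 le_N *.
pose P := (A * ((n * n * m).+1) ^ n)%N.
have {}le_N : (N <= P * tau ^ (n * n) * q ^ k * q ^ (k * m))%N.
  apply: leq_trans le_N _; rewrite -[leqRHS]mulnA -expnD -mulnS mulnA leq_mul2r.
  apply/orP; right; rewrite /P /A !expnMn -!expnM (mulnA n n m).
  by rewrite -!mulnA.
apply: leq_trans (leq_expl s le_N) _; rewrite expnMn -expnM.
rewrite expnD mulnC [(k * m * s)%N]mulnC leq_mul2l; apply/orP; right.
(* After fourth powers the budget is [4 * m]: one [m] for the constants in [P], two for the divisor
   count, one for [q ^ k]. *)
rewrite -(@leq_exp2r _ _ 4) // -!expnM.
have le_P : (P ^ (s * 4) <= q ^ m)%N.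
  rewrite /P expnMn -expnM; apply: leq_trans (le_M1 m _) _; first by lia.
  exact: leq_expl.
move: P le_P {le_N} => P le_P.
rewrite !expnMn -!expnM; have -> : (m * 4 = m + 2 * m + m)%N by lia.
rewrite (expnD _ (m + 2 * m)) (expnD _ m) leq_mul //; last by rewrite leq_exp2l //; lia.
by rewrite leq_mul // -mulnA.
Qed.

(** The denominator is [2 * k * (2 * k - 1)], which is at least the square of [2 * k - 1]. *)
Lemma half_exponent_condition (R : realType) (k m n : nat) : (0 < k)%N -> (0 < m)%N ->
  m%:R < n%:R / (4 * k%:R ^+ 2 - 2 * k%:R) :> R ->
  ((k + k).-1 * (k + k).-1 * m.-1 < n)%N.
Proof.
case: k m => [//|k] [//|m] _ _.
have -> : 4 * k.+1%:R ^+ 2 - 2 * k.+1%:R = ((k.+1 + k.+1) * (k + k).+1)%:R :> R.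
  by rewrite natrM !natrD -!natr1 natrD; ring.
rewrite ltr_pdivlMr ?ltr0n // -natrM ltr_nat; apply: leq_ltn_trans.
by rewrite addnS addSn /= mulnC leq_mul // leq_mul.
Qed.

Local Open Scope classical_set_scope.
Local Open Scope ring_scope.

Theorem theorem1p1 (R : realType) (k : nat) (hk : (1 <= k)%N) :
  exists delta : nat -> R,
    delta @ \oo --> (0 : R) /\
    forall (F : finFieldType) (n : nat) (psi : {poly F})
           (hpsi : monic_irreducible_poly psi)
           (gamma : {poly F}) (m : nat),
      (1 <= n)%N -> size psi = n.+1 -> (1 <= m)%N ->
      m%:R < n%:R / (4 * k%:R ^+ 2 - 2 * k%:R) :> R ->
      (Nsol hpsi k gamma m)%:R <=
        (#|F|%:R : R) `^ ((k%:R + delta m) * m%:R).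
Proof.
have [M MP] := choice (fun s => @Nsol_growth k s hk).
(* The best available exponent [k + 1 / s] at [m]: the largest [s <= m] whose threshold has been
   passed. It depends on [k] and [m] only and tends to infinity. *)
pose s m := (\max_(s < m.+1 | (M s <= m)%N) s)%N.
(* The value [k] for [s m = 0] turns the claim into the trivial bound with exponent
   [(k + k) * m]. *)
exists (fun m => if s m == 0%N then k%:R else (s m)%:R^-1); split.
  apply/cvgrPdist_le => eps eps_gt0; pose s0 := (Num.truncn eps^-1).+1.
  exists (s0 + M s0)%N => // m /= le_m; rewrite sub0r normrN.
  have lt_s0 : (s0 < m.+1)%N by rewrite ltnS (leq_trans _ le_m) ?leq_addr.
  have le_s : (s0 <= s m)%N.
    by rewrite /s (bigop.bigmax_sup (Ordinal lt_s0)) // (leq_trans _ le_m) ?leq_addl.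
  have s_gt0 : (0 < s m)%N by apply: leq_trans le_s.
  rewrite gtn_eqF // ger0_norm ?invr_ge0 ?ler0n //.
  rewrite -[leRHS]invrK lef_pV2 ?posrE ?invr_gt0 ?ltr0n //.
  apply: le_trans (ltW (truncnS_gt _)) _; by rewrite ler_nat.
move=> F n psi hpsi gamma m _ spsi m_gt0 /(@half_exponent_condition _ _ _ _ hk m_gt0) small.
have q_gt1 : (1 < #|F|)%N by apply: finNzRing_gt1.
have q0 : (0 : R) <= #|F|%:R by rewrite ler0n.
have [_|s_gt0] := posnP (s m).
  have -> : (k%:R + k%:R) * m%:R = (m * (k + k))%:R :> R by rewrite natrM natrD mulrC.
  by rewrite powR_mulrn // -natrX ler_nat Nsol_trivial.
have le_Ms : (M (s m) <= m)%N.
  rewrite /s; have := @eq_bigmax_cond _ [pred i : 'I_m.+1 | (M i <= m)%N] val.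
  case=> [|i]; last by rewrite inE => le_i ->.
  rewrite lt0n; apply/eqP => card0; move: s_gt0; rewrite /s big_pred0 // => i.
  by have := card0_eq card0 i; rewrite inE.
have small' : ((k + k).-1 * (k + k).-1 * m.-1 < (size psi).-1)%N by rewrite spsi.
have := MP (s m) m le_Ms m_gt0 F psi hpsi gamma small'.
set N := Nsol _ _ _ _ => le_N; set x := _ `^ _.
have x0 : 0 <= x by apply: powR_ge0.
rewrite -(@ler_pXn2r _ (s m)) ?nnegrE ?ler0n // -natrX.
have -> : x ^+ s m = (#|F| ^ (s m * (k * m) + m))%:R.
  rewrite /x -powR_mulrn // -powRrM natrX -powR_mulrn //; congr (_ `^ _).
  by rewrite natrD !natrM; field; rewrite pnatr_eq0 -lt0n.
by rewrite ler_nat.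
Qed.
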